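(* Let $k$ be a field of characteristic zero, and let $f,g\in k[x]$ be nonconstant. A non-graph $k$-rational one-infinity component of $C_{f,g}$ with $d_X=2$ is, after linear changes of the coordinates $X$ and $Y$, obtained from the switched first-kind Bilu–Tichy pair $\bigl(UE(U)^2,\,V^2\bigr)$, $E\in k[U]\setminus\{0\}$. More precisely, such a component exists if and only if there are $c,\beta\in k$, $\alpha\in k^*$, $E\in k[U]\setminus\{0\}$, $G\in k[Z]\setminus k$ such that $$g(Y)=G((Y-c)^2)\quad\text{and}\quad f(X)=G\left(\frac{X-\beta}{\alpha}\,E\left(\frac{X-\beta}{\alpha}\right)^2\right).$$ Equivalently, with $U=(X-\beta)/\alpha$ and $V=Y-c$, one has $$f=G\circ F\circ\lambda_X,\qquad g=G\circ Q\circ\lambda_Y,$$ where $F(U)=UE(U)^2$, $Q(V)=V^2$, $\lambda_X(X)=(X-\beta)/\alpha$, $\lambda_Y(Y)=Y-c$. The pair $(F,Q)$ is the switched first-kind Bilu–Tichy standard pair with $m=2$, $r=1$, $a=1$, $p=E$. The corresponding component is parametrized by $U=t^2$, $V=tE(t^2)$, or, in the original coordinates, $$X=\alpha t^2+\beta,\qquad Y=c+tE(t^2).$$ It is not a graph component.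
   Context: $C_{f,g}=(f(X)-g(Y)=0)_{\mathrm{red}}\subset\mathbb A^2_k$. For a geometrically integral component $C$, $C^\nu$ is its affine normalization and $\widetilde C$ its smooth projective normalization; $C$ is a $k$-rational one-infinity component if it is a geometrically integral component over $k$ with $\widetilde C\cong\mathbb P^1_k$ and $\widetilde C\setminus C^\nu$ consisting of exactly one geometric point. $d_X(C)=[k(C):k(X)]$. A graph component is one of the form $Y=h(X)$ with $h\in k[X]$, $f=g\circ h$. A first-kind Bilu–Tichy standard pair over $k$ is, up to switching the two coordinates, a pair $\bigl(x^m,\ a x^r p(x)^m\bigr)$ with $a\in k^*$, $p\in k[x]$, $m\ge2$, $0\le r<m$, $(r,m)=1$, and $r+\deg p>0$; ''switched'' means the two entries are interchanged. *)

(* Defs.v *)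
From HB Require Import structures.
From mathcomp Require Import all_boot all_order all_algebra.

Set Implicit Arguments.
Unset Strict Implicit.
Unset Printing Implicit Defensive.

Import GRing.Theory.
Local Open Scope ring_scope.

(* Convention: k[X,Y] is {poly {poly k}}, with X the inner variable and Y the
   outer one.  Thus X is 'X%:P, Y is 'X, a polynomial f(X) is f%:P, and a
   polynomial g(Y) is map_poly polyC g. *)

(* The value R(x,y), the coefficients being sent to S by phi. *)
Definition eval2 (k S : nzRingType) (phi : k -> S) (x y : S)
    (R : {poly {poly k}}) : S :=
  (map_poly (fun a : {poly k} => (map_poly phi a).[x]) R).[y].

Definition curve_poly (k : fieldType) (f g : {poly k}) : {poly {poly k}} :=
  f%:P - map_poly polyC g.

(* Divisibility in the ring itself; polydiv's %| is pseudo-divisibility over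
   a coefficient ring such as k[X], i.e. divisibility in k(X)[Y]. *)
Definition divides (A : comNzRingType) (p q : A) : Prop :=
  exists r : A, q = r * p.

Definition same_ideal (A : comNzRingType) (p q : A) : Prop :=
  divides p q /\ divides q p.

(* p is nonzero and A/(p) is an integral domain. *)
Definition prime_elt (A : comNzRingType) (p : A) : Prop :=
  [/\ p <> 0, ~ divides p 1
    & forall a b : A, divides p (a * b) -> divides p a \/ divides p b].

(* A component of C_{f,g}, given by a generator of its prime ideal in k[X,Y],
   together with a model of its function field k(C) = Frac (k[X,Y]/(P)), which
   these axioms determine up to a unique k-isomorphism respecting X and Y. *)
Record component (k : fieldType) (f g : {poly k}) := Component {
  comp_eqn : {poly {poly k}};
  comp_prime : prime_elt comp_eqn;
  comp_divides : divides comp_eqn (curve_poly f g);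
  funfield : fieldType;
  ff_const : {rmorphism k -> funfield};
  ff_X : funfield;
  ff_Y : funfield;
  ff_kernel : forall R : {poly {poly k}},
    eval2 ff_const ff_X ff_Y R = 0 <-> divides comp_eqn R;
  ff_generated : forall z : funfield, exists A B : {poly {poly k}},
    eval2 ff_const ff_X ff_Y B <> 0 /\
    z = eval2 ff_const ff_X ff_Y A / eval2 ff_const ff_X ff_Y B
}.

(* The subfield k(x) of L. *)
Definition in_simple_ext (k L : fieldType) (i : {rmorphism k -> L}) (x z : L)
    : Prop :=
  exists a b : {poly k},
    (map_poly i b).[x] <> 0 /\ z = (map_poly i a).[x] / (map_poly i b).[x].

(* [L : S] = n, for a subfield S of L. *)
Definition ext_degree (L : fieldType) (S : L -> Prop) (n : nat) : Prop :=
  exists e : 'I_n -> L,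
    (forall z : L, exists2 c : 'I_n -> L,
       forall i, S (c i) & z = \sum_(i < n) c i * e i) /\
    (forall c : 'I_n -> L, (forall i, S (c i)) ->
       \sum_(i < n) c i * e i = 0 -> forall i, c i = 0).

Definition d_X (k : fieldType) (f g : {poly k}) (C : component f g) (n : nat)
    : Prop :=
  ext_degree (in_simple_ext (ff_const C) (ff_X C)) n.

Definition graph_component (k : fieldType) (f g : {poly k})
    (C : component f g) : Prop :=
  exists h : {poly k},
    f = g \Po h /\ same_ideal (comp_eqn C) ('X - h%:P).

(* The base change of the component to kbar is integral. *)
Definition geom_integral (k : fieldType) (kbar : closedFieldType)
    (j : {rmorphism k -> kbar}) (f g : {poly k}) (C : component f g) : Prop :=
  prime_elt (map_poly (map_poly j) (comp_eqn C)).

(* A smooth projective curve is k-isomorphic to P^1 iff its function field is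
   k-isomorphic to k(t). *)
Definition normalization_is_P1 (k : fieldType) (f g : {poly k})
    (C : component f g) : Prop :=
  exists theta : {rmorphism {fraction {poly k}} -> funfield C},
    (forall c : k, theta (tofrac c%:P) = ff_const C c) /\ bijective theta.

(* A kbar-valued k-place of L, None being infinity.  When L is the function
   field of C and kbar is algebraic over k, these are the geometric points of
   the smooth projective model of C: by the valuative criterion of properness,
   a kbar-point is a valuation ring {z | phi z <> None} of L over k together
   with a k-embedding of its residue field in kbar. *)
Definition is_place (k L : fieldType) (kbar : closedFieldType)
    (i : {rmorphism k -> L}) (j : {rmorphism k -> kbar})
    (phi : L -> option kbar) : Prop :=
  [/\ forall c : k, phi (i c) = Some (j c),
      forall u v a b, phi u = Some a -> phi v = Some b ->
        phi (u + v) = Some (a + b) /\ phi (u * v) = Some (a * b)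
    & forall u, phi u = None -> phi u^-1 = Some 0].

(* The geometric point phi lies on the affine normalization, whose coordinate
   ring is the integral closure of k[C] in k(C). *)
Definition on_affine_normalization (k : fieldType) (f g : {poly k})
    (C : component f g) (T : Type) (phi : funfield C -> option T) : Prop :=
  forall z : funfield C,
    integralOver (eval2 (ff_const C) (ff_X C) (ff_Y C)) z -> phi z <> None.

Definition point_at_infinity (k : fieldType) (kbar : closedFieldType)
    (j : {rmorphism k -> kbar}) (f g : {poly k}) (C : component f g)
    (phi : funfield C -> option kbar) : Prop :=
  is_place (ff_const C) j phi /\ ~ on_affine_normalization phi.

Definition one_infinity (k : fieldType) (kbar : closedFieldType)
    (j : {rmorphism k -> kbar}) (f g : {poly k}) (C : component f g) : Prop :=
  exists phi : funfield C -> option kbar,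
    point_at_infinity j phi /\
    forall psi : funfield C -> option kbar,
      point_at_infinity j psi -> psi =1 phi.

Definition rational_one_infinity_component (k : fieldType)
    (kbar : closedFieldType) (j : {rmorphism k -> kbar}) (f g : {poly k})
    (C : component f g) : Prop :=
  [/\ geom_integral j C, normalization_is_P1 C & one_infinity j C].

(* The curve P = 0 is parametrized by t |-> (x(t), y(t)): its ideal is the
   vanishing ideal of the parametrization, k(x(t), y(t)) = k(t), and every
   geometric point of the curve is attained. *)
Definition parametrized_by (k : fieldType) (kbar : closedFieldType)
    (j : {rmorphism k -> kbar}) (P : {poly {poly k}}) (x y : {poly k})
    : Prop :=
  [/\ forall R : {poly {poly k}},
        eval2 (@polyC k) x y R = 0 <-> divides P R,
      exists A B : {poly {poly k}}, eval2 (@polyC k) x y B <> 0 /\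
        eval2 (@polyC k) x y A = 'X * eval2 (@polyC k) x y B
    & forall a b : kbar, eval2 j a b P = 0 <->
        exists t : kbar, a = (map_poly j x).[t] /\ b = (map_poly j y).[t]].

(* The first-kind Bilu-Tichy pair (x^m, a x^r p(x)^m).  The condition
   r + deg p > 0 excludes p = 0, whose degree is -oo. *)
Definition first_kind_pair (k : fieldType) (m r : nat) (a : k) (p : {poly k})
    (F G : {poly k}) : Prop :=
  [/\ a != 0 /\ p != 0, (2 <= m)%N, (r < m)%N /\ coprime r m,
      (0 < r + (size p).-1)%N
    & F = 'X^m /\ G = a *: ('X^r * p ^+ m)].

Definition switched_first_kind_pair (k : fieldType) (m r : nat) (a : k)
    (p : {poly k}) (F G : {poly k}) : Prop :=
  first_kind_pair m r a p G F.

Definition polF (k : fieldType) (E : {poly k}) : {poly k} := 'X * E ^+ 2.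

Definition polQ (k : fieldType) : {poly k} := 'X^2.

Definition lambdaX (k : fieldType) (alpha beta : k) : {poly k} :=
  alpha^-1 *: ('X - beta%:P).

Definition lambdaY (k : fieldType) (c : k) : {poly k} := 'X - c%:P.

Definition decomposition (k : fieldType) (f g : {poly k}) (c beta alpha : k)
    (E G : {poly k}) : Prop :=
  [/\ alpha != 0, E != 0, (1 < size G)%N,
      g = G \Po (('X - c%:P) ^+ 2)
    & f = G \Po ((alpha^-1 *: ('X - beta%:P)) *
                 (E \Po (alpha^-1 *: ('X - beta%:P))) ^+ 2)].

(* The equation F(lambda_X(X)) - Q(lambda_Y(Y)), i.e. the curve F(U) = Q(V)
   after the linear changes of coordinates U = lambda_X(X), V = lambda_Y(Y). *)
Definition pair_eqn (k : fieldType) (c beta alpha : k) (E : {poly k})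
    : {poly {poly k}} :=
  curve_poly (polF E \Po lambdaX alpha beta) (polQ k \Po lambdaY c).

Definition paramX (k : fieldType) (alpha beta : k) : {poly k} :=
  alpha *: 'X^2 + beta%:P.

Definition paramY (k : fieldType) (c : k) (E : {poly k}) : {poly k} :=
  c%:P + 'X * (E \Po 'X^2).

(* Main.v *)
Require Import Defs.
From HB Require Import structures.
From mathcomp Require Import all_boot all_order all_algebra.
From mathcomp Require Import zify ring.
Import GRing.Theory.
Local Open Scope ring_scope.

Set Implicit Arguments.
Unset Strict Implicit.
Unset Printing Implicit Defensive.

(* A k-rational component with one point at infinity has function field k(t),
   and the only pole of X and Y is a single geometric point of P^1; being
   unique it is k-rational in characteristic 0, so after a change of t both
   X = x(t) and Y = y(t) are polynomials.  Then [k(t) : k(x(t))] = deg x = 2,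
   and completing the square gives x = alpha t^2 + beta.  Since f(x(t)) is even,
   y = u + v with u even and v odd and nonzero satisfies g(u + v) = g(u - v),
   which by comparing degrees forces u to be a constant c and g to be even about
   c.  Conversely, (U, V) = (t^2, t E(t^2)) generates k(t), and its ideal is
   generated by V^2 - U E(U)^2, by division with remainder in V. *)

(** * Evaluation of polynomials *)

(** No general formula for [k(t) : k(x(t))] is proved. Degree 2 only has to exclude deg x = 1, where
    k(x) is all of k(t), and x constant or deg x at least 3, where 1, t, t^2 are independent over
    k(x). Points at infinity are handled as poles of X or Y, so integral closure enters only through
    the finiteness of a place on whatever is integral over a ring where it is finite. The odd part v
    is nonzero because otherwise X and Y, hence all of k(C), would lie in k(t^2), which does not
    contain t. Comparing leading terms gives y(t) - c = eps (y(-t) - c) with eps = (-1)^(deg y); eps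
    = 1 would give v = 0, so eps = -1 and u = c. The shape of f then comes by cancellation: f(x(t))
    = g(y(t)) = G((y(t) - c)^2) = G(F(lambda_X(x(t)))), and right composition with the nonconstant x
    is injective. *)

Definition evalp (k S : nzRingType) (phi : k -> S) (t : S) (p : {poly k}) : S :=
  (map_poly phi p).[t].

Section Evaluation.
Variables (k S : comNzRingType) (phi : {rmorphism k -> S}).

Fact evalp_is_zmod_morphism t : zmod_morphism (evalp phi t).
Proof. by move=> p q; rewrite /evalp rmorphB hornerD hornerN. Qed.

Fact evalp_is_monoid_morphism t : monoid_morphism (evalp phi t).
Proof.
by split=> [|p q]; rewrite /evalp ?rmorph1 ?hornerC // rmorphM hornerM.
Qed.

HB.instance Definition _ t :=
  GRing.isZmodMorphism.Build {poly k} S (evalp phi t) (evalp_is_zmod_morphism t).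
HB.instance Definition _ t :=
  GRing.isMonoidMorphism.Build {poly k} S (evalp phi t)
    (evalp_is_monoid_morphism t).

Lemma evalpD t p q : evalp phi t (p + q) = evalp phi t p + evalp phi t q.
Proof. exact: rmorphD. Qed.

Lemma evalpB t p q : evalp phi t (p - q) = evalp phi t p - evalp phi t q.
Proof. exact: rmorphB. Qed.

Lemma evalpM t p q : evalp phi t (p * q) = evalp phi t p * evalp phi t q.
Proof. exact: rmorphM. Qed.

Lemma evalpXn t p n : evalp phi t (p ^+ n) = evalp phi t p ^+ n.
Proof. exact: rmorphXn. Qed.

Lemma evalp0 t : evalp phi t 0 = 0.
Proof. exact: rmorph0. Qed.

Lemma evalp1 t : evalp phi t 1 = 1.
Proof. exact: rmorph1. Qed.

Lemma evalpC t a : evalp phi t a%:P = phi a.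
Proof. by rewrite /evalp map_polyC hornerC. Qed.

Lemma evalpX t : evalp phi t 'X = t.
Proof. by rewrite /evalp map_polyX hornerX. Qed.

Lemma evalpZ t a p : evalp phi t (a *: p) = phi a * evalp phi t p.
Proof. by rewrite -mul_polyC evalpM evalpC. Qed.

Lemma evalp_comp t p q : evalp phi t (p \Po q) = evalp phi (evalp phi t q) p.
Proof. by rewrite /evalp map_comp_poly horner_comp. Qed.

End Evaluation.

Lemma evalp_polyC (k : comNzRingType) (x p : {poly k}) :
  evalp (@polyC k) x p = p \Po x.
Proof. by []. Qed.

Lemma rmorph_evalp (k S T : comNzRingType) (phi : {rmorphism k -> S})
    (psi : {rmorphism k -> T}) (h : {rmorphism S -> T}) :
  (forall a, h (phi a) = psi a) ->
  forall t p, h (evalp phi t p) = evalp psi (h t) p.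
Proof.
move=> hE t p; rewrite /evalp -horner_map -map_poly_comp.
by congr (_.[_]); apply: eq_map_poly.
Qed.

Section Evaluation2.
Variables (k S : comNzRingType) (phi : {rmorphism k -> S}) (x y : S).

Lemma eval2E R : eval2 phi x y R = evalp (evalp phi x) y R.
Proof. by []. Qed.

HB.instance Definition _ :=
  GRing.RMorphism.copy (eval2 phi x y) (evalp (evalp phi x) y).

Lemma eval2D P Q : eval2 phi x y (P + Q) = eval2 phi x y P + eval2 phi x y Q.
Proof. exact: rmorphD. Qed.

Lemma eval2B P Q : eval2 phi x y (P - Q) = eval2 phi x y P - eval2 phi x y Q.
Proof. exact: rmorphB. Qed.

Lemma eval2N P : eval2 phi x y (- P) = - eval2 phi x y P.
Proof. exact: rmorphN. Qed.

Lemma eval2M P Q : eval2 phi x y (P * Q) = eval2 phi x y P * eval2 phi x y Q.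
Proof. exact: rmorphM. Qed.

Lemma eval2Xn P n : eval2 phi x y (P ^+ n) = eval2 phi x y P ^+ n.
Proof. exact: rmorphXn. Qed.

Lemma eval2_0 : eval2 phi x y 0 = 0.
Proof. exact: rmorph0. Qed.

Lemma eval2_1 : eval2 phi x y 1 = 1.
Proof. exact: rmorph1. Qed.

Lemma eval2C p : eval2 phi x y p%:P = evalp phi x p.
Proof. by rewrite eval2E evalpC. Qed.

Lemma eval2Y : eval2 phi x y 'X = y.
Proof. by rewrite eval2E evalpX. Qed.

Lemma eval2X : eval2 phi x y 'X%:P = x.
Proof. by rewrite eval2C evalpX. Qed.

Lemma eval2_map q : eval2 phi x y (map_poly polyC q) = evalp phi y q.
Proof.
rewrite eval2E {1}/evalp -(map_poly_comp (evalp phi x)); congr (_.[_]).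
by apply: eq_map_poly => a /=; rewrite evalpC.
Qed.

Lemma integral_eval2 R : integralOver (eval2 phi x y) (eval2 phi x y R).
Proof. exact: integral_id. Qed.

End Evaluation2.

Lemma rmorph_eval2 (k S T : comNzRingType) (phi : {rmorphism k -> S})
    (psi : {rmorphism k -> T}) (h : {rmorphism S -> T}) :
  (forall a, h (phi a) = psi a) ->
  forall x y R, h (eval2 phi x y R) = eval2 psi (h x) (h y) R.
Proof.
move=> hE x y R; rewrite !eval2E.
by apply: (rmorph_evalp (phi := evalp phi x)) => p /=; apply: rmorph_evalp.
Qed.

(** For transcendental t this reduces relations between x(t) and y(t) in a field to identities in
    k[t]. *)
Lemma eval2_evalp (k S : comNzRingType) (phi : {rmorphism k -> S}) t x y R :
  eval2 phi (evalp phi t x) (evalp phi t y) R =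
  evalp phi t (eval2 polyC x y R).
Proof.
symmetry.
apply: (rmorph_eval2 (phi := polyC) (psi := phi) (h := evalp phi t)) => a.
exact: evalpC.
Qed.

Section Divides.
Variable A : comNzRingType.
Implicit Types p q r : A.

Lemma divides_refl p : divides p p.
Proof. by exists 1; rewrite mul1r. Qed.

Lemma divides_trans p q r : divides p q -> divides q r -> divides p r.
Proof. by case=> a -> [b ->]; exists (b * a); rewrite mulrA. Qed.

End Divides.

(** Primality is read off from a parametrization with values in a domain, so no factorization
    argument is needed, over k or over kbar. *)
Lemma prime_elt_kernel (k : comNzRingType) (D : idomainType)
    (phi : {rmorphism k -> D}) (x y : D) (P : {poly {poly k}}) :
  P <> 0 -> (forall R, eval2 phi x y R = 0 <-> divides P R) -> prime_elt P.
Proof.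
move=> P0 hP; split=> // [/hP /eqP|a b /hP].
  by rewrite eval2_1 oner_eq0.
by move/eqP; rewrite eval2M mulf_eq0 => /orP[] /eqP /hP; [left|right].
Qed.

(** The two summands have disjoint supports: the coefficient of index 2i sees only p, that of index
    2i+1 only q. *)
Lemma even_odd_eq0 (R : nzRingType) (p q : {poly R}) :
  (p \Po 'X^2) + (q \Po 'X^2) * 'X = 0 -> p = 0 /\ q = 0.
Proof.
move/polyP => e; split; apply/polyP => i.
  have := e (i.*2); rewrite coefD coefMX !coef_comp_poly_Xn // !coef0.
  rewrite -muln2 dvdn_mull // mulnK //; case: i => [|i]; rewrite ?addr0 //=.
  suff -> : (2 %| (i * 2).+1)%N = false by rewrite addr0.
  by rewrite dvdn2 /= oddM andbF.
have := e (i.*2.+1); rewrite coefD coefMX !coef_comp_poly_Xn // !coef0 /=.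
by rewrite -muln2 dvdn_mull // mulnK // dvdn2 /= oddM andbF add0r.
Qed.

(** * The curve U E(U)^2 = V^2 *)

Lemma size2_polyE (R : nzRingType) (p : {poly R}) :
  (size p <= 2)%N -> p = (p`_0)%:P + (p`_1)%:P * 'X.
Proof.
move=> sp; apply/polyP => -[|[|i]]; rewrite coefD coefMX !coefC ?addr0 ?add0r //=.
by rewrite nth_default // (leq_trans sp).
Qed.

Lemma polF_comp (k : fieldType) (E l : {poly k}) :
  polF E \Po l = l * (E \Po l) ^+ 2.
Proof. by rewrite /polF comp_polyM comp_polyX rmorphXn. Qed.

Section PairCurve.
Variables (k : fieldType) (c beta alpha : k) (E : {poly k}).
Hypotheses (alpha0 : alpha != 0) (E0 : E != 0).

Local Notation F := (polF E \Po lambdaX alpha beta).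
Local Notation x := (paramX alpha beta).
Local Notation y := (paramY c E).

Lemma pair_eqnE : pair_eqn c beta alpha E = F%:P - ('X - c%:P%:P) ^+ 2.
Proof.
rewrite /pair_eqn /curve_poly /polQ /lambdaY; congr (_ - _).
by rewrite comp_Xn_poly rmorphXn rmorphB /= map_polyX map_polyC.
Qed.

Lemma lambdaX_param : lambdaX alpha beta \Po x = 'X^2.
Proof.
rewrite /lambdaX /paramX comp_polyZ comp_polyB comp_polyX comp_polyC addrK.
by rewrite scalerA mulVf // scale1r.
Qed.

Lemma paramX_comp : x = (alpha *: 'X + beta%:P) \Po 'X^2.
Proof. by rewrite comp_polyD comp_polyZ comp_polyX comp_polyC. Qed.

Lemma size_affine : size (alpha *: 'X + beta%:P) = 2.
Proof. by rewrite -mul_polyC size_MXaddC polyC_eq0 (negPf alpha0) size_polyC alpha0. Qed.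

Lemma even_in_X p : p \Po 'X^2 = (p \Po lambdaX alpha beta) \Po x.
Proof. by rewrite -comp_polyA lambdaX_param. Qed.

Lemma F_param : F \Po x = (y - c%:P) ^+ 2.
Proof.
rewrite -even_in_X /polF /paramY addrC addKr exprMn comp_polyM comp_polyX.
by rewrite !expr2 comp_polyM.
Qed.

Lemma pair_eqn_param : eval2 polyC x y (pair_eqn c beta alpha E) = 0.
Proof.
rewrite pair_eqnE eval2B eval2Xn eval2B !eval2C eval2Y evalpC evalp_polyC.
by rewrite F_param subrr.
Qed.

Lemma param_independent p q :
  (p \Po x) + (q \Po x) * y = 0 -> p = 0 /\ q = 0.
Proof.
rewrite paramX_comp !comp_polyA; set l := _ + _%:P => e.
(* As x is a polynomial in t^2 and y = c + t E(t^2), the relation splits by parity: even part p + c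
   q, odd part q E, both taken at x. *)
have [pq0 qE0] : (p + c *: q) \Po l = 0 /\ (q \Po l) * E = 0.
  apply: even_odd_eq0; rewrite -[RHS]e /paramY comp_polyM !comp_polyD !comp_polyZ.
  by rewrite -mul_polyC; ring.
have sl := size_affine.
have q0 : q = 0.
  apply/eqP; rewrite -(comp_poly2_eq0 _ sl) //.
  by move/eqP: qE0; rewrite mulf_eq0 (negPf E0) orbF.
by move: pq0; rewrite q0 scaler0 addr0 => /eqP; rewrite comp_poly2_eq0 // => /eqP.
Qed.

Lemma size_opp_pair_eqn : size (- pair_eqn c beta alpha E) = 3.
Proof.
rewrite pair_eqnE opprB size_polyDl size_exp_XsubC // size_polyN.
by apply: leq_ltn_trans (size_polyC_leq1 _) _.
Qed.

Lemma opp_pair_eqn_monic : - pair_eqn c beta alpha E \is monic.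
Proof.
rewrite monicE pair_eqnE opprB lead_coefDl.
  by rewrite lead_coef_exp lead_coefXsubC expr1n.
rewrite size_polyN size_exp_XsubC.
by apply: leq_ltn_trans (size_polyC_leq1 _) _.
Qed.

Lemma pair_eqn_neq0 : pair_eqn c beta alpha E <> 0.
Proof.
by apply/eqP; rewrite -oppr_eq0; apply: monic_neq0 opp_pair_eqn_monic.
Qed.

(* Up to sign, [pair_eqn] is monic of degree 2 in Y, so the remainder of R
   modulo it is linear in Y, and 1, y are independent over k(x). *)
Lemma pair_eqn_kernel R :
  eval2 polyC x y R = 0 <-> divides (pair_eqn c beta alpha E) R.
Proof.
split=> [|[q ->]]; last by rewrite eval2M pair_eqn_param mulr0.
have := Pdiv.RingMonic.rdivp_eq opp_pair_eqn_monic R.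
set q := Pdiv.Ring.rdivp R _; set r := Pdiv.Ring.rmodp R _ => RE.
have sr : (size r <= 2)%N.
  have := Pdiv.Ring.ltn_rmodpN0 R (monic_neq0 opp_pair_eqn_monic).
  by rewrite size_opp_pair_eqn.
rewrite RE (size2_polyE sr) eval2D eval2M eval2N pair_eqn_param oppr0.
rewrite mulr0 add0r eval2D eval2M !eval2C eval2Y !evalp_polyC.
case/param_independent => -> ->; exists (- q).
by rewrite polyC0 mul0r !addr0 mulrN mulNr.
Qed.

Lemma prime_pair_eqn : prime_elt (pair_eqn c beta alpha E).
Proof.
exact: prime_elt_kernel pair_eqn_neq0 pair_eqn_kernel.
Qed.

(** On the parametrization, Y = h(X) would be a relation between 1 and y over k[x] in which y has
    coefficient 1. *)
Lemma not_graph_pair_eqn h : ~ divides (pair_eqn c beta alpha E) ('X - h%:P).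
Proof.
move/pair_eqn_kernel; rewrite eval2B eval2Y eval2C evalp_polyC => e.
have [] : - h = 0 /\ 1 = 0 :> {poly k}.
  by apply: param_independent; rewrite rmorphN rmorph1 /= mul1r addrC.
by move=> _ /eqP; rewrite oner_eq0.
Qed.

Section Points.
Variables (kbar : closedFieldType) (j : {rmorphism k -> kbar}).

Lemma pair_eqn_eval a b : eval2 j a b (pair_eqn c beta alpha E) =
  evalp j ((j alpha)^-1 * (a - j beta)) (polF E) - (b - j c) ^+ 2.
Proof.
rewrite pair_eqnE eval2B eval2Xn eval2B !eval2C eval2Y evalpC evalp_comp.
by rewrite /lambdaX evalpZ evalpB evalpX evalpC fmorphV.
Qed.

Lemma evalp_paramX (S : comNzRingType) (phi : {rmorphism k -> S}) t :
  evalp phi t x = phi alpha * t ^+ 2 + phi beta.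
Proof. by rewrite /paramX evalpD evalpZ evalpXn evalpX evalpC. Qed.

Lemma evalp_paramY (S : comNzRingType) (phi : {rmorphism k -> S}) t :
  evalp phi t y = phi c + t * evalp phi (t ^+ 2) E.
Proof.
by rewrite /paramY evalpD evalpM evalp_comp evalpXn evalpX evalpC.
Qed.

Lemma closed_sqrt (u : kbar) : exists v, v ^+ 2 = u.
Proof.
have /closed_rootP[v] : size ('X^2 - u%:P) != 1%N by rewrite size_XnsubC.
by rewrite /root !hornerE subr_eq0 => /eqP; exists v.
Qed.

Lemma pair_eqn_points a b : eval2 j a b (pair_eqn c beta alpha E) = 0 <->
  exists t : kbar, a = (map_poly j x).[t] /\ b = (map_poly j y).[t].
Proof.
have ja0 : j alpha != 0 by rewrite fmorph_eq0.
rewrite pair_eqn_eval; set u := _ * (a - _).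
have aE : a = j alpha * u + j beta by rewrite /u mulVKf // subrK.
rewrite /polF evalpM evalpX evalpXn; split.
  move/eqP; rewrite subr_eq0 => /eqP e.
  (* The parameter is V / E(U), except at the zeros of E: there V = 0 and any square root of U
     serves. *)
  have [e0|e0] := eqVneq (evalp j u E) 0.
    have [t tu] := closed_sqrt u; exists t.
    rewrite -![(map_poly _ _).[_]]/(evalp j _ _) evalp_paramX evalp_paramY tu.
    split=> //; rewrite e0 mulr0 addr0.
    apply/eqP; move/esym/eqP: e; rewrite e0 expr0n mulr0 expf_eq0 /= subr_eq0.
    by [].
  exists ((b - j c) / evalp j u E).
  have tu : ((b - j c) / evalp j u E) ^+ 2 = u.
    by rewrite expr_div_n -e mulfK // expf_neq0.
  rewrite -![(map_poly _ _).[_]]/(evalp j _ _) evalp_paramX evalp_paramY tu.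
  by split=> //; rewrite divfK // addrC subrK.
case=> t; rewrite -![(map_poly _ _).[_]]/(evalp j _ _) evalp_paramX evalp_paramY.
rewrite {1}aE => -[/addIr/(mulfI ja0) -> ->].
by rewrite [j c + _]addrC addrK exprMn subrr.
Qed.

Lemma parametrized_pair_eqn :
  parametrized_by j (pair_eqn c beta alpha E) x y.
Proof.
split; first exact: pair_eqn_kernel; last exact: pair_eqn_points.
(* This is t = (Y - c) / E(lambda_X(X)). *)
exists ('X - c%:P%:P), (E \Po lambdaX alpha beta)%:P.
rewrite eval2B eval2Y !eval2C evalpC evalp_polyC -even_in_X; split.
  by apply/eqP; rewrite comp_poly_eq0 ?size_polyXn.
by rewrite /paramY [c%:P + _]addrC addrK.
Qed.

End Points.
End PairCurve.

(** Base change keeps the shape of the equation, so geometric integrality is [prime_pair_eqn] over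
    kbar. *)
Lemma map_pair_eqn (k kbar : fieldType) (j : {rmorphism k -> kbar})
    (c beta alpha : k) (E : {poly k}) :
  map_poly (map_poly j) (pair_eqn c beta alpha E) =
  pair_eqn (j c) (j beta) (j alpha) (map_poly j E).
Proof.
rewrite !pair_eqnE rmorphB rmorphXn rmorphB /= map_polyX !map_polyC /=.
rewrite map_polyC map_comp_poly /polF /lambdaX map_polyZ fmorphV.
by rewrite rmorphM rmorphXn rmorphB /= !map_polyX map_polyC.
Qed.

(** * Polynomials g with g(u + v) = g(u - v) *)

Lemma coef_XsubC_exp (R : comNzRingType) (c : R) e :
  (('X - c%:P) ^+ e.+1)`_e = - c *+ e.+1.
Proof.
elim: e => [|e IH]; first by rewrite expr1 coefB coefX coefC sub0r.
rewrite exprS mulrBl coefB coefXM coefCM /= IH.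
have /monicP := monic_exp e.+1 (monicXsubC c).
rewrite /lead_coef size_exp_XsubC /= => ->.
by rewrite mulr1 [RHS]mulrSr.
Qed.

Section CharacteristicZero.
Variable k : fieldType.
Hypothesis char0 : [pchar k] =i pred0.

Lemma natf_neq0_char0 n : (n.+1%:R != 0 :> k).
Proof. by rewrite (proj1 (pcharf0P k) char0). Qed.

Lemma power_plus_lower (g : {poly k}) :
  exists (c : k) (r : {poly k}),
    g = lead_coef g *: ('X - c%:P) ^+ (size g).-1 + r /\
    (size r <= (size g).-2)%N.
Proof.
case sg: (size g) => [|[|e]] /=.
- exists 0, 0; move/eqP: sg; rewrite size_poly_eq0 => /eqP ->.
  by rewrite lead_coef0 scale0r addr0 size_poly0.
- exists 0, 0; rewrite addr0 size_poly0 expr0 alg_polyC; split=> //.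
  by rewrite [LHS]size1_polyC ?sg // /lead_coef sg.
have a0 : lead_coef g != 0 by rewrite lead_coef_eq0 -size_poly_eq0 sg.
(* In lc (X - c)^(e+1) the coefficient of degree e is -(e+1) c lc; this c makes it equal to that of
   g, dividing by e+1 in characteristic 0. *)
pose c := - (g`_e / (lead_coef g * e.+1%:R)).
exists c, (g - lead_coef g *: ('X - c%:P) ^+ e.+1).
split; first by rewrite addrC subrK.
apply/leq_sizeP => i le_i; rewrite coefB coefZ.
move: le_i; rewrite leq_eqVlt => /orP[/eqP <-|].
  rewrite coef_XsubC_exp /c opprK -[_ *+ e.+1]mulr_natr.
  have := natf_neq0_char0 e; set N := _%:R => N0.
  by clearbody N; field; rewrite N0 a0.
rewrite leq_eqVlt => /orP[/eqP <-|lt_i].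
  have /monicP := monic_exp e.+1 (monicXsubC c).
  rewrite /lead_coef size_exp_XsubC /= => ->.
  by rewrite sg mulr1 subrr.
by rewrite !nth_default ?mulr0 ?subrr ?size_exp_XsubC ?sg.
Qed.

(** No cancellation at the top: all e+1 terms have degree e deg y and the same leading coefficient,
    and e+1 is invertible in characteristic 0. *)
Lemma size_geometric_sum (y w : {poly k}) e :
  y != 0 -> size y = size w -> lead_coef y = lead_coef w ->
  ((size y).-1 * e < size (\sum_(i < e.+1) y ^+ (e - i) * w ^+ i)%R)%N.
Proof.
move=> y0 syw lyw; set S := \sum_(i < _) _.
have w0 : w != 0 by rewrite -size_poly_eq0 -syw size_poly_eq0.
suff : S`_((size y).-1 * e) != 0.
  by rewrite ltnNge; apply: contra => sS; rewrite nth_default.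
have -> : S`_((size y).-1 * e) = lead_coef y ^+ e *+ e.+1.
  rewrite coef_sum -[X in _ *+ X]card_ord -sumr_const; apply: eq_bigr => i _.
  have ie : (i <= e)%N by rewrite -ltnS.
  have <- : lead_coef (y ^+ (e - i) * w ^+ i) = lead_coef y ^+ e.
    by rewrite lead_coefM !lead_coef_exp -lyw -exprD subnK.
  rewrite /lead_coef size_mul ?expf_neq0 //; congr (_`_ _).
  have := size_exp y (e - i); have := size_exp w i.
  have : (0 < size (y ^+ (e - i)))%N by rewrite size_poly_gt0 expf_neq0.
  have : (0 < size (w ^+ i))%N by rewrite size_poly_gt0 expf_neq0.
  rewrite -syw; set m := (size y).-1.
  move: (size (y ^+ _)) (size (w ^+ _)) => [//|A] [//|B] /= _ _ -> ->.
  by rewrite addnS /= -mulnDr subnK.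
by rewrite -mulr_natr mulf_neq0 ?natf_neq0_char0 // expf_neq0 // lead_coef_eq0.
Qed.

(* After completing the d-th power, g = a (Y - c)^d + r with deg r <= d - 2.
   With w = eps (y2 - c), the difference of the leading parts is
   (y1 - c - w) times a sum of degree (d - 1) deg y1, too large to be
   compensated by r. *)
Lemma comp_poly_eq_sign (g y1 y2 : {poly k}) (eps : k) :
  (1 < size g)%N -> (1 < size y1)%N -> size y1 = size y2 ->
  eps ^+ 2 = 1 -> lead_coef y2 = eps * lead_coef y1 ->
  g \Po y1 = g \Po y2 ->
  exists c : k, y1 - c%:P = eps *: (y2 - c%:P).
Proof.
move=> sg sy1 s12 eps2 l2 e12.
have [c [r [gE sr]]] := power_plus_lower g.
exists c; apply/eqP; rewrite -subr_eq0; apply/eqP.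
set a := lead_coef g in gE; set d := (size g).-1 in gE.
have a0 : a != 0 by rewrite lead_coef_eq0 -size_poly_gt0 (ltn_trans _ sg).
have eps0 : eps != 0.
  by apply: contraTneq (oner_neq0 k) => e0; rewrite -eps2 e0 expr0n /= eqxx.
have sC (y : {poly k}) : (1 < size y)%N -> size (y - c%:P) = size y.
  move=> sy; rewrite size_polyDl // size_polyN.
  by rewrite (leq_ltn_trans (size_polyC_leq1 _)).
have lC (y : {poly k}) : (1 < size y)%N -> lead_coef (y - c%:P) = lead_coef y.
  move=> sy; rewrite lead_coefDl // size_polyN.
  by rewrite (leq_ltn_trans (size_polyC_leq1 _)).
have sy2 : (1 < size y2)%N by rewrite -s12.
set z1 := y1 - c%:P; set w := eps *: _.
have z10 : z1 != 0 by rewrite -size_poly_gt0 sC // (ltn_trans _ sy1).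
have szw : size z1 = size w by rewrite size_scale // !sC.
have lzw : lead_coef z1 = lead_coef w.
  by rewrite lead_coefZ !lC // l2 mulrA -expr2 eps2 mul1r.
have l10 : lead_coef y1 != 0 by rewrite lead_coef_eq0 -size_poly_gt0 (ltn_trans _ sy1).
(* Comparing leading coefficients in g(y1) = g(y2); thus w^d = (y2 - c)^d. *)
have epsd : eps ^+ d = 1.
  have := congr1 lead_coef e12; rewrite !lead_coef_comp // l2 exprMn -/d -/a.
  move/(mulfI a0)/esym/eqP; rewrite -subr_eq0 -[X in _ - X]mul1r -mulrBl.
  by rewrite mulf_eq0 expf_eq0 (negPf l10) andbF orbF subr_eq0 => /eqP.
have compE (y : {poly k}) : g \Po y = a *: (y - c%:P) ^+ d + (r \Po y).
  by rewrite gE comp_polyD comp_polyZ rmorphXn /= comp_polyB comp_polyX comp_polyC.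
apply/eqP; apply/negPn/negP => z1w.
have [e dE] : exists e, d = e.+1 by exists d.-1; rewrite prednK // -ltnS prednK // ltnW.
have key : a *: (z1 - w) * (\sum_(i < e.+1) z1 ^+ (e - i) * w ^+ i) =
    (r \Po y2) - (r \Po y1).
  have wd : w ^+ d = (y2 - c%:P) ^+ d by rewrite exprZn epsd scale1r.
  rewrite -scalerAl -(subrXX z1 w e.+1) -dE wd scalerBr.
  apply/eqP; rewrite subr_eq addrAC eq_sym subr_eq eq_sym.
  by rewrite -!compE e12 [X in _ == X]addrC -compE.
have := size_geometric_sum e z10 szw lzw; rewrite -/z1 (sC _ sy1).
set S := \sum_(i < _) _ in key *.
have : S %| (r \Po y2) - (r \Po y1) by rewrite -key dvdp_mull.
have S0 : S != 0.
  by rewrite -size_poly_gt0 (leq_ltn_trans _ (size_geometric_sum e z10 szw lzw)).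
have RHS0 : (r \Po y2) - (r \Po y1) != 0.
  by rewrite -key mulf_neq0 // scaler_eq0 negb_or a0.
move/(dvdp_leq RHS0) => sS lS.
have := leq_trans lS sS; rewrite ltnNge => /negP; apply.
apply: leq_trans (size_polyD _ _) _; rewrite size_polyN geq_max.
have r0 : r != 0 by apply: contraNneq RHS0 => ->; rewrite !comp_poly0 subrr.
have sr1 : ((size r).-1 < e)%N.
  have : (0 < size r)%N by rewrite size_poly_gt0.
  by move: sr; rewrite -/d; have : d = e.+1 by []; rewrite /d; lia.
(* As deg r < e, r(y) has degree at most (e-1) deg y1, below the degree e deg y1 of S. *)
have H (y : {poly k}) : size y = size y1 -> (size (r \Po y) <= (size y1).-1 * e)%N.
  move=> sy; apply: leq_trans (size_comp_poly_leq _ _) _; rewrite sy.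
  move: sr1 sy1; move: (size r).-1 (size y1) => A [//|B] /= Ae B0.
  by rewrite mulnC; apply: leq_trans (leq_mul (leqnn B) Ae); rewrite mulnS; lia.
by rewrite !H.
Qed.

Lemma comp_poly_even (g p q : {poly k}) :
  (1 < size g)%N -> q != 0 ->
  g \Po ((p \Po 'X^2) + 'X * (q \Po 'X^2)) =
    g \Po ((p \Po 'X^2) - 'X * (q \Po 'X^2)) ->
  exists c, p = c%:P.
Proof.
move=> sg q0; set u := p \Po _; set v := q \Po _ => e12.
have two0 : (2%:R != 0 :> k) by exact: natf_neq0_char0 1.
set y1 := u + _ in e12; set y2 := u - _ in e12.
have y2E : y2 = y1 \Po (-1 *: 'X).
  rewrite /y1 /y2 comp_polyD comp_polyM comp_polyX /u /v -!comp_polyA.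
  by rewrite comp_Xn_poly exprZn sqrrN expr1n !scale1r scaleN1r mulNr.
have sNX : size (-1 *: 'X : {poly k}) = 2.
  by rewrite size_scale ?size_polyX // oppr_eq0 oner_neq0.
have s12 : size y1 = size y2 by rewrite y2E size_comp_poly2.
have sy1 : (1 < size y1)%N.
  rewrite ltnNge; apply/negP => /size1_polyC y1C.
  have [_ /eqP] : p - (y1`_0)%:P = 0 /\ q = 0; last by rewrite (negPf q0).
  by apply: even_odd_eq0; rewrite comp_polyB comp_polyC -y1C /y1 -/u -/v; ring.
have l2 : lead_coef y2 = (-1) ^+ (size y1).-1 * lead_coef y1.
  by rewrite y2E lead_coef_comp ?sNX // lead_coefZ lead_coefX mulr1 mulrC.
have [] := comp_poly_eq_sign sg sy1 s12 (sqrr_sign _ _) l2 e12.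
(* For odd degree the sign is -1 and adding y1 - c and y2 - c gives 2 (u - c) = 0. For even degree
   y1 = y2, so 2v = 0, against q being nonzero. *)
move=> c; rewrite -signr_odd; case: (odd _) => /= e; exists c.
  have : (p - c%:P) *+ 2 = 0 /\ (0 : {poly k}) = 0.
    apply: even_odd_eq0; rewrite comp_poly0 mul0r addr0 mulr2n comp_polyD.
    rewrite comp_polyB comp_polyC -[p \Po _]/u.
    have -> : u - c%:P + (u - c%:P) = y1 - c%:P + (y2 - c%:P).
      by rewrite /y1 /y2; ring.
    by rewrite e expr1 scaleN1r addNr.
  case=> /eqP; rewrite -mulr_natl mulf_eq0 -polyC_natr polyC_eq0 (negPf two0) /=.
  by rewrite subr_eq0 => /eqP.
have [_ /eqP] : (0 : {poly k}) = 0 /\ q *+ 2 = 0.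
  apply: even_odd_eq0; rewrite comp_poly0 add0r mulr2n comp_polyD.
  have -> : ((q \Po 'X^2) + (q \Po 'X^2)) * 'X = y1 - c%:P - (y2 - c%:P).
    by rewrite /y1 /y2 -/v; ring.
  by rewrite e expr0 scale1r subrr.
rewrite -mulr_natl mulf_eq0 -polyC_natr polyC_eq0 (negPf two0) /=.
by rewrite (negPf q0).
Qed.

End CharacteristicZero.

(** * Simple transcendental extensions and their places *)

Section SimpleExtension.
Variables (k L : fieldType) (i : {rmorphism k -> L}).
Implicit Types (x z t u v : L) (p q : {poly k}).

Lemma in_simple_extP x z : in_simple_ext i x z <->
  exists a b, evalp i x b <> 0 /\ z = evalp i x a / evalp i x b.
Proof. by []. Qed.

Lemma in_simple_ext_evalp x p : in_simple_ext i x (evalp i x p).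
Proof.
apply/in_simple_extP; exists p, 1; rewrite evalp1 divr1; split=> //.
exact/eqP/oner_neq0.
Qed.

Lemma in_simple_ext_gen x : in_simple_ext i x x.
Proof. by have := in_simple_ext_evalp x 'X; rewrite evalpX. Qed.

Lemma in_simple_ext_const x a : in_simple_ext i x (i a).
Proof. by have := in_simple_ext_evalp x a%:P; rewrite evalpC. Qed.

Lemma in_simple_extD x u v :
  in_simple_ext i x u -> in_simple_ext i x v -> in_simple_ext i x (u + v).
Proof.
move=> /in_simple_extP[a [b [/eqP b0 ->]]] /in_simple_extP[c [d [/eqP d0 ->]]].
apply/in_simple_extP; exists (a * d + c * b), (b * d).
rewrite evalpD !evalpM; split; first by apply/eqP; rewrite mulf_neq0.
by rewrite addf_div.
Qed.

Lemma in_simple_extM x u v :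
  in_simple_ext i x u -> in_simple_ext i x v -> in_simple_ext i x (u * v).
Proof.
move=> /in_simple_extP[a [b [/eqP b0 ->]]] /in_simple_extP[c [d [/eqP d0 ->]]].
apply/in_simple_extP; exists (a * c), (b * d).
rewrite !evalpM; split; first by apply/eqP; rewrite mulf_neq0.
by rewrite mulf_div.
Qed.

Lemma in_simple_extV x u : in_simple_ext i x u -> in_simple_ext i x u^-1.
Proof.
move=> /in_simple_extP[a [b [/eqP b0 ->]]].
have [a0|a0] := eqVneq (evalp i x a) 0.
  by rewrite a0 mul0r invr0 -(rmorph0 i); apply: in_simple_ext_const.
apply/in_simple_extP; exists b, a; split; first exact/eqP.
by rewrite invf_div.
Qed.

Lemma in_simple_ext_trans x t z :
  in_simple_ext i t x -> in_simple_ext i x z -> in_simple_ext i t z.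
Proof.
move=> xt /in_simple_extP[a [b [_ ->]]].
suff H p : in_simple_ext i t (evalp i x p).
  by apply: in_simple_extM => //; apply: in_simple_extV.
elim/poly_ind: p => [|p c IH].
  by rewrite evalp0 -(rmorph0 i); apply: in_simple_ext_const.
rewrite evalpD evalpM evalpX evalpC; apply: in_simple_extD.
  exact: in_simple_extM.
exact: in_simple_ext_const.
Qed.

(** An internal form of L = k(t): a change of parameter is just another element of L with this
    property. *)
Definition rational_generator t :=
  ~ algebraicOver i t /\ forall z, in_simple_ext i t z.

Lemma transcendental_inj t p :
  ~ algebraicOver i t -> evalp i t p = 0 -> p = 0.
Proof.
move=> tr pt0; apply/eqP/negPn/negP => p0; apply: tr; exists p => //.
exact/eqP.
Qed.

Lemma transcendental_eq t p q :
  ~ algebraicOver i t -> evalp i t p = evalp i t q -> p = q.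
Proof.
move=> tr e; apply/eqP; rewrite -subr_eq0; apply/eqP/(transcendental_inj tr).
by rewrite evalpB e subrr.
Qed.

Lemma transcendental_neq0 t p :
  ~ algebraicOver i t -> p != 0 -> evalp i t p != 0.
Proof. by move=> tr; apply: contra => /eqP /(transcendental_inj tr) ->. Qed.

Lemma rational_generator_neq0 t : rational_generator t -> t != 0.
Proof.
case=> tr _; rewrite -(evalpX i t).
by apply: transcendental_neq0; rewrite ?polyX_eq0.
Qed.

Lemma rational_generatorB t a :
  rational_generator t -> rational_generator (t - i a).
Proof.
case=> tr gen; have alg_a : algebraicOver i (i a) by exact: algebraic_id.
split=> [alg|z].
  by apply: tr; rewrite -(subrK (i a) t); apply: algebraic_add.
apply: in_simple_ext_trans (gen z).
rewrite -{2}(subrK (i a) t); apply: in_simple_extD.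
  exact: in_simple_ext_gen.
exact: in_simple_ext_const.
Qed.

Lemma rational_generatorV t : rational_generator t -> rational_generator t^-1.
Proof.
case=> tr gen; split=> [alg|z].
  by apply: tr; rewrite -[t]invrK; apply: algebraic_inv.
apply: in_simple_ext_trans (gen z).
by rewrite -{2}[t]invrK; apply: in_simple_extV; apply: in_simple_ext_gen.
Qed.

(** Stated with a pair and a boolean condition so that [xchoose] can select a reduced fraction. *)
Lemma coprime_fraction t z : rational_generator t ->
  exists nd : {poly k} * {poly k}, [&& coprimep nd.1 nd.2, nd.2 != 0
    & z == evalp i t nd.1 / evalp i t nd.2].
Proof.
case=> tr gen; have /in_simple_extP[n [d [/eqP d0 ->]]] := gen z.
have d0' : d != 0 by apply: contraNneq d0 => ->; rewrite evalp0.
pose g := gcdp n d; have g0 : g != 0 by rewrite gcdp_eq0 negb_and d0' orbT.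
have nE : n = n %/ g * g by rewrite divpK ?dvdp_gcdl.
have dE : d = d %/ g * g by rewrite divpK ?dvdp_gcdr.
exists (n %/ g, d %/ g) => /=; apply/and3P; split.
- by rewrite coprimep_div_gcd // d0' orbT.
- by apply: contraNneq d0' => e; rewrite dE e mul0r.
- by rewrite {1}nE {1}dE !evalpM -mulf_div divff ?mulr1 ?transcendental_neq0.
Qed.

Section Places.
Variables (kbar : closedFieldType) (j : {rmorphism k -> kbar}).
Implicit Types (phi psi : L -> option kbar).

Section APlace.
Variable phi : L -> option kbar.
Hypothesis Hphi : is_place i j phi.

Lemma place_const a : phi (i a) = Some (j a).
Proof. by case: Hphi. Qed.

Lemma placeD u v a b :
  phi u = Some a -> phi v = Some b -> phi (u + v) = Some (a + b).
Proof. by case: Hphi => _ H _ hu hv; case: (H _ _ _ _ hu hv). Qed.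

Lemma placeM u v a b :
  phi u = Some a -> phi v = Some b -> phi (u * v) = Some (a * b).
Proof. by case: Hphi => _ H _ hu hv; case: (H _ _ _ _ hu hv). Qed.

Lemma placeV_None u : phi u = None -> phi u^-1 = Some 0.
Proof. by case: Hphi => _ _; apply. Qed.

Lemma place0 : phi 0 = Some 0.
Proof. by rewrite -(rmorph0 i) place_const rmorph0. Qed.

Lemma place1 : phi 1 = Some 1.
Proof. by rewrite -(rmorph1 i) place_const rmorph1. Qed.

Lemma place_inv_Some0 u : u != 0 -> phi u = Some 0 -> phi u^-1 = None.
Proof.
move=> u0 pu; case pV: (phi u^-1) => [b|//].
have := placeM pu pV; rewrite mulfV // place1 mul0r => -[] /eqP.
by rewrite oner_eq0.
Qed.

Lemma placeV u a : phi u = Some a -> a != 0 -> phi u^-1 = Some a^-1.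
Proof.
move=> pu a0; have u0 : u != 0.
  by apply: contraNneq a0 => u0; move: pu; rewrite u0 place0 => -[->].
case pV: (phi u^-1) => [b|].
  have := placeM pu pV; rewrite mulfV // place1 => -[ab].
  by congr Some; apply: (mulfI a0); rewrite -ab mulfV.
by have := placeV_None pV; rewrite invrK pu => -[/eqP]; rewrite (negPf a0).
Qed.

Lemma place_evalp u a p : phi u = Some a -> phi (evalp i u p) = Some (evalp j a p).
Proof.
move=> pu; elim/poly_ind: p => [|p c IH]; first by rewrite !evalp0 place0.
rewrite !evalpD !evalpM !evalpX !evalpC; apply: placeD; last exact: place_const.
exact: placeM.
Qed.

Lemma place_eval2 x y a b R : phi x = Some a -> phi y = Some b ->
  phi (eval2 i x y R) = Some (eval2 j a b R).
Proof.
move=> px py; elim/poly_ind: R => [|R c IH]; first by rewrite !eval2_0 place0.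
rewrite !eval2D !eval2M !eval2Y !eval2C; apply: placeD; last exact: place_evalp.
exact: placeM.
Qed.

Lemma place_sum (I : Type) (r : seq I) (G : I -> L) (a : I -> kbar) :
  (forall l, phi (G l) = Some (a l)) ->
  phi (\sum_(l <- r) G l) = Some (\sum_(l <- r) a l).
Proof.
move=> H; elim: r => [|l r IH]; first by rewrite !big_nil place0.
by rewrite !big_cons; apply: placeD.
Qed.

Lemma placeXn u a n : phi u = Some a -> phi (u ^+ n) = Some (a ^+ n).
Proof.
by move=> pu; elim: n => [|n IH]; rewrite ?place1 // !exprS; apply: placeM.
Qed.

(* If z had a pole, dividing its integral equation by z^deg and applying the
   place would give 1 = 0. *)
Lemma place_integral (A : comNzRingType) (h : {rmorphism A -> L}) z :
  (forall r, phi (h r) <> None) -> integralOver h z -> phi z <> None.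
Proof.
move=> fin [p pm pz0] pz.
have z0 : z != 0 by apply: contra_eq_neq pz => ->; rewrite place0.
have pV := placeV_None pz.
pose n := (size p).-1.
have pE : size (map_poly h p) = n.+1.
  by rewrite size_map_poly_id0 ?prednK ?size_poly_gt0 ?monic_neq0 //
     (monicP pm) rmorph1 oner_neq0.
have eq0 : \sum_(l < n.+1) h p`_l * z^-1 ^+ (n - l) = 0.
  transitivity ((map_poly h p).[z] * z^-1 ^+ n); last by rewrite (eqP pz0) mul0r.
  rewrite horner_coef pE mulr_suml; apply: eq_bigr => l _.
  rewrite coef_map -mulrA; congr (_ * _).
  have ln : (l <= n)%N by rewrite -ltnS.
  by rewrite -[X in _ * z^-1 ^+ X](subnKC ln) exprD mulrA -exprMn mulfV // expr1n mul1r.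
(* Every value is finite by [fin], so the default 0 is never taken. *)
have [a Ha] : exists a : nat -> kbar, forall l, phi (h p`_l) = Some (a l).
  exists (fun l => odflt 0 (phi (h p`_l))) => l.
  by case e: (phi _) (fin p`_l).
have : phi (\sum_(l < n.+1) h p`_l * z^-1 ^+ (n - l)) =
       Some (\sum_(l < n.+1) a l * 0 ^+ (n - l)).
  by apply: place_sum => l; apply: placeM => //; apply: placeXn.
(* Only the top term survives: its exponent is 0 and its coefficient is 1. *)
rewrite eq0 place0 big_ord_recr /= subnn expr0 mulr1 big1 => [|l _].
  rewrite add0r; have := Ha n; rewrite -/(lead_coef p) (monicP pm).
  by rewrite rmorph1 place1 => -[<-] [/eqP]; rewrite eq_sym oner_eq0.
by rewrite expr0n subn_eq0 leqNgt ltn_ord mulr0.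
Qed.

End APlace.

Lemma coprime_evalp_neq0 (a : kbar) p q :
  coprimep p q -> evalp j a q = 0 -> evalp j a p != 0.
Proof.
rewrite -(coprimep_map j) coprimep_sym => cpq q0.
by apply: (coprimep_root cpq); apply/eqP.
Qed.

(** The value at t fixes that of every reduced fraction n/d: n(a)/d(a) if d(a) is nonzero, and a
    pole otherwise, since then n(a) is nonzero. *)
Lemma place_unique t phi psi a : rational_generator t ->
  is_place i j phi -> is_place i j psi ->
  phi t = Some a -> psi t = Some a -> phi =1 psi.
Proof.
move=> gt Hphi Hpsi pt qt z.
have [[n d] /and3P[/= cnd d0 /eqP zE]] := coprime_fraction z gt.
have [da|da] := eqVneq (evalp j a d) 0.
  have na := coprime_evalp_neq0 cnd da.
  have H xi : is_place i j xi -> xi t = Some a -> xi z = None.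
    move=> Hxi xt; have := place_evalp Hxi n xt; have := place_evalp Hxi d xt.
    rewrite da => xd xn; rewrite zE -[_ / _]invf_div.
    have n0 : evalp i t n != 0.
      apply: contraNneq na => n0; move: xn; rewrite n0 (place0 Hxi) => -[<-].
      by [].
    apply: (place_inv_Some0 Hxi).
      by rewrite mulf_neq0 ?invr_eq0 //; apply: transcendental_neq0 => //; case: gt.
    by rewrite -[0](mul0r (evalp j a n)^-1); apply: placeM => //; apply: placeV.
  by rewrite !H.
have H xi : is_place i j xi -> xi t = Some a ->
    xi z = Some (evalp j a n / evalp j a d).
  move=> Hxi xt; rewrite zE; apply: (placeM Hxi); first exact: place_evalp.
  by apply: (placeV Hxi) => //; apply: place_evalp.
by rewrite !H.
Qed.

(** The place is evaluation of reduced fractions at a. The last clause records the poles, which the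
    axioms of a place leave implicit. *)
Lemma place_exists t (a : kbar) : rational_generator t ->
  exists phi, [/\ is_place i j phi, phi t = Some a
    & forall n d, coprimep n d -> d != 0 -> evalp j a d = 0 ->
        phi (evalp i t n / evalp i t d) = None].
Proof.
move=> gt; have [tr _] := gt.
pose nd z := xchoose (coprime_fraction z gt).
have ndP z : [/\ coprimep (nd z).1 (nd z).2, (nd z).2 != 0
    & z = evalp i t (nd z).1 / evalp i t (nd z).2].
  by have /and3P[? ? /eqP] := xchooseP (coprime_fraction z gt).
pose phi z := if evalp j a (nd z).2 == 0 then None
  else Some (evalp j a (nd z).1 / evalp j a (nd z).2).
(* Transcendence of t turns equality of two fractions into an identity of polynomials, which can be
   evaluated at a; hence independence of the chosen fraction. *)
have cross z n d : d != 0 -> z = evalp i t n / evalp i t d ->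
    n * (nd z).2 = (nd z).1 * d.
  move=> d0 zE; have [_ d0' zE'] := ndP z.
  apply: (transcendental_eq tr); rewrite !evalpM.
  apply/eqP; rewrite -eqr_div ?transcendental_neq0 //.
  by rewrite -zE {1}zE'.
have phiE z n d : evalp j a d != 0 -> z = evalp i t n / evalp i t d ->
    phi z = Some (evalp j a n / evalp j a d).
  move=> da zE; have d0 : d != 0 by apply: contraNneq da => ->; rewrite evalp0.
  have := congr1 (evalp j a) (cross z n d d0 zE); rewrite !evalpM.
  have [cp _ _] := ndP z; rewrite /phi; case: eqP => [e|/eqP da' e].
    have na := coprime_evalp_neq0 cp e; rewrite e mulr0 => /esym/eqP.
    by rewrite mulf_eq0 (negPf na) (negPf da).
  by congr Some; apply/eqP; rewrite eqr_div // -e.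
have phiN z n d : coprimep n d -> d != 0 -> evalp j a d = 0 ->
    z = evalp i t n / evalp i t d -> phi z = None.
  move=> cp d0 da zE; rewrite /phi; case: eqP => // /eqP da'.
  have := congr1 (evalp j a) (cross z n d d0 zE); rewrite !evalpM da mulr0.
  by move/eqP; rewrite mulf_eq0 (negPf da') (negPf (coprime_evalp_neq0 cp da)).
have phiS z b : phi z = Some b -> exists n d,
    [/\ evalp j a d != 0, z = evalp i t n / evalp i t d
      & b = evalp j a n / evalp j a d].
  rewrite /phi; case: eqP => // /eqP da [<-]; have [_ _ zE] := ndP z.
  by exists (nd z).1, (nd z).2.
have nz d : evalp j a d != 0 -> evalp i t d != 0.
  move=> da; apply: transcendental_neq0 => //.
  by apply: contraNneq da => ->; rewrite evalp0.
exists phi; split; last by move=> n d cp d0 da; apply: phiN cp d0 da _.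
  split.
  - move=> c; rewrite (phiE _ c%:P 1) ?evalp1 ?oner_neq0 // !evalpC ?divr1 //.
  - move=> u v b c /phiS[n [d [da uE bE]]] /phiS[n' [d' [da' vE cE]]].
    split.
      rewrite (phiE _ (n * d' + n' * d) (d * d')) ?evalpD ?evalpM ?mulf_neq0 //.
        by rewrite bE cE addf_div.
      by rewrite uE vE addf_div ?nz.
    rewrite (phiE _ (n * n') (d * d')) ?evalpM ?mulf_neq0 //.
      by rewrite bE cE mulf_div.
    by rewrite uE vE mulf_div.
  - move=> u pu; have e : evalp j a (nd u).2 = 0 by move: pu; rewrite /phi; case: eqP.
    have [cp d0 uE] := ndP u.
    have na := coprime_evalp_neq0 cp e.
    rewrite (phiE _ (nd u).2 (nd u).1) // ?e ?mul0r //.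
    by rewrite {1}uE invf_div.
by rewrite (phiE _ 'X 1) ?evalp1 ?oner_neq0 // !evalpX ?divr1.
Qed.

End Places.
End SimpleExtension.

(** * A single point at infinity *)

Lemma fraction_numden (R : idomainType) (z : {fraction R}) :
  exists n d : R, d != 0 /\ z * tofrac d = tofrac n.
Proof.
elim/quotW: z => x; have dx := denom_ratioP x.
exists (\n_x), (\d_x); split=> //.
change (FracField.mul (\pi x)%qT (tofrac \d_x) = tofrac \n_x).
rewrite !piE /FracField.mulf !numden_Ratio ?oner_eq0 // mulr1.
apply/eqmodP; rewrite /= FracField.equivfE !numden_Ratio ?oner_eq0 //.
by rewrite mulr1 mulrC.
Qed.

Section FractionGenerator.
Variables (k L : fieldType) (i : {rmorphism k -> L}).
Variable theta : {rmorphism {fraction {poly k}} -> L}.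
Hypothesis thetaC : forall c : k, theta (tofrac c%:P) = i c.

Lemma theta_evalp p : theta (tofrac p) = evalp i (theta (tofrac 'X)) p.
Proof.
elim/poly_ind: p => [|p c IH]; first by rewrite evalp0 !rmorph0.
by rewrite evalpD evalpM evalpX evalpC -thetaC -IH tofracD tofracM rmorphD rmorphM.
Qed.

Lemma fraction_rational_generator :
  bijective theta -> rational_generator i (theta (tofrac 'X)).
Proof.
move=> bij; split=> [[p p0 /eqP]|z].
  rewrite -[_.[_]]/(evalp i _ p) -theta_evalp => /eqP.
  by rewrite fmorph_eq0 tofrac_eq0 (negPf p0).
have [eta _ etaK] := bij; have [n [d [d0 e]]] := fraction_numden (eta z).
have td : theta (tofrac d) != 0 by rewrite fmorph_eq0 tofrac_eq0.
apply/in_simple_extP; exists n, d; rewrite -!theta_evalp; split; first exact/eqP.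
by rewrite -e rmorphM etaK mulfK.
Qed.

End FractionGenerator.

Section PolynomialGenerator.
Variables (k L : fieldType) (i : {rmorphism k -> L}).
Variables (kbar : closedFieldType) (j : {rmorphism k -> kbar}).
Hypothesis char0 : [pchar k] =i pred0.

(** A nonconstant denominator would have a root a in kbar, and the place t = a would be a pole of x
    with t finite. *)
Lemma polynomial_of_no_finite_pole t x : rational_generator i t ->
  (forall phi, is_place i j phi -> phi x = None -> phi t = None) ->
  exists p, x = evalp i t p.
Proof.
move=> gt nopole; have [[n d] /and3P[/= cnd d0 /eqP xE]] := coprime_fraction x gt.
have [sd|] := eqVneq (size (map_poly j d)) 1%N.
  have /size_poly1P [c c0 dE] : size d == 1%N by rewrite -sd size_map_poly.
  by exists (c^-1 *: n); rewrite evalpZ fmorphV mulrC xE dE evalpC.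
move/closed_rootP => -[a /eqP da].
have [phi [Hphi pt /(_ n d cnd d0 da) px]] := place_exists j a gt.
by have := nopole phi Hphi; rewrite xE px pt => /(_ erefl).
Qed.

Variables (x y : L).
(** When x and y are the coordinate functions of a component, these are exactly its points at
    infinity, by [polar_at_infinity] and [at_infinity_polar]. *)
Definition polar (phi : L -> option kbar) :=
  is_place i j phi /\ (phi x = None \/ phi y = None).
Hypothesis polar_unique : forall phi psi, polar phi -> polar psi -> phi =1 psi.

(* All roots of the denominator d are polar points, hence equal to one a; as
   d has coefficients in k and k has characteristic 0, a lies in k, and the
   unique pole is moved to infinity by t = 1/(s - a). *)
Lemma move_pole_to_infinity s n d : rational_generator i s ->
  coprimep n d -> d != 0 -> size d != 1%N ->
  (evalp i s n / evalp i s d = x \/ evalp i s n / evalp i s d = y) ->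
  exists2 t, rational_generator i t & forall phi, polar phi -> phi t = None.
Proof.
move=> gs cnd d0 sd xy.
have root_polar a : root (map_poly j d) a ->
    exists2 phi, polar phi & phi s = Some a.
  move=> /eqP da; have [phi [Hphi ps /(_ n d cnd d0 da) pz]] := place_exists j a gs.
  by exists phi => //; split=> //; case: xy => <-; [left|right].
have [rs dE] := closed_field_poly_normal (map_poly j d).
have lc0 : j (lead_coef d) != 0 by rewrite fmorph_eq0 lead_coef_eq0.
have lcE : lead_coef (map_poly j d) = j (lead_coef d) by rewrite lead_coef_map.
rewrite lcE in dE.
have rootE z : root (map_poly j d) z = (z \in rs).
  by rewrite dE rootZ // root_prod_XsubC.
have srs : size d = (size rs).+1.
  by rewrite -(size_map_poly j) dE size_scale // size_prod_XsubC.
case: rs => [|a rs] in dE rootE srs *; first by rewrite srs in sd.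
have [phi0 polar0 phi0s] : exists2 phi, polar phi & phi s = Some a.
  by apply: root_polar; rewrite rootE mem_head.
have all_a z : z \in a :: rs -> z = a.
  rewrite -rootE => /root_polar[phi Hphi ps].
  by have := polar_unique Hphi polar0 s; rewrite ps phi0s => -[].
set m := size (a :: rs) in srs.
have rsE : a :: rs = nseq m a.
  by apply/all_pred1P/allP => z /all_a -> /=.
have m0 : (m%:R != 0 :> k) by rewrite (proj1 (pcharf0P k) char0).
(* The common root, recovered in k as the mean of the roots: d = lc (T - a)^m has second coefficient
   -m a lc. *)
pose a0 := - (d`_m.-1 / (lead_coef d * m%:R)).
have aE : a = j a0.
  have : j d`_m.-1 = - (j (lead_coef d) * (a *+ m)).
    rewrite -coef_map dE coefZ -[m]/(size (a :: rs)) coefPn_prod_XsubC //.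
    by rewrite rsE big_nseq iter_addr addr0 mulrN size_nseq.
  move=> e; rewrite /a0 rmorphN fmorph_div rmorphM rmorph_nat e -mulr_natr.
  have := m0; rewrite -(fmorph_eq0 j) rmorph_nat; set M := m%:R => M0.
  by field; rewrite M0 lc0.
clearbody a0; have sa0 : s - i a0 != 0.
  have := transcendental_neq0 (proj1 gs) (p := 'X - a0%:P).
  by rewrite evalpB evalpX evalpC; apply; rewrite polyXsubC_eq0.
exists (s - i a0)^-1; first exact/rational_generatorV/rational_generatorB.
move=> phi Hphi; have [Hp _] := Hphi.
apply: (place_inv_Some0 Hp) => //.
have ps : phi s = Some a by rewrite (polar_unique Hphi polar0).
have := placeD Hp ps (place_const Hp (- a0)).
by rewrite !rmorphN -aE subrr.
Qed.

Lemma polynomial_generator s : rational_generator i s ->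
  exists t p q, [/\ rational_generator i t, x = evalp i t p & y = evalp i t q].
Proof.
move=> gs.
suff [t gt pole_t] :
    exists2 t, rational_generator i t & forall phi, polar phi -> phi t = None.
  have [|p xE] := @polynomial_of_no_finite_pole t x gt.
    by move=> phi Hphi px; apply: pole_t; split=> //; left.
  have [|q yE] := @polynomial_of_no_finite_pole t y gt.
    by move=> phi Hphi py; apply: pole_t; split=> //; right.
  by exists t, p, q.
have [[n d] /and3P[/= cnd d0 /eqP xE]] := coprime_fraction x gs.
have [[n' d'] /and3P[/= cnd' d0' /eqP yE]] := coprime_fraction y gs.
have [sd|sd] := eqVneq (size d) 1%N; last first.
  by apply: (move_pole_to_infinity gs cnd d0 sd); left.
have [sd'|sd'] := eqVneq (size d') 1%N; last first.
  by apply: (move_pole_to_infinity gs cnd' d0' sd'); right.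
(* Both denominators are constant: X and Y are already polynomials in s, so a pole of either is a
   pole of s. *)
exists s => // phi [Hphi px]; case ps: (phi s) => [a|] //.
have fin (n0 d1 : {poly k}) : size d1 = 1%N -> phi (evalp i s n0 / evalp i s d1) <> None.
  move/eqP/size_poly1P => [c c0 ->]; rewrite evalpC -fmorphV.
  by rewrite (placeM Hphi (place_evalp Hphi n0 ps) (place_const Hphi _)).
by case: px => e; [have := fin n d sd | have := fin n' d' sd'];
  rewrite -?xE -?yE e => /(_ erefl).
Qed.

End PolynomialGenerator.

Section ComponentAtInfinity.
Variables (k : fieldType) (kbar : closedFieldType) (j : {rmorphism k -> kbar}).
Variables (f g : {poly k}) (C : component f g).
Local Notation i := (ff_const C).
Local Notation ev := (eval2 i (ff_X C) (ff_Y C)).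

Lemma polar_at_infinity phi :
  polar i j (ff_X C) (ff_Y C) phi -> point_at_infinity j phi.
Proof.
case=> Hphi xy; split=> // aff.
have H R := integral_eval2 i (ff_X C) (ff_Y C) R.
case: xy; [rewrite -(eval2X i (ff_X C) (ff_Y C))|rewrite -(eval2Y i (ff_X C) (ff_Y C))];
  exact: aff (H _).
Qed.

(** If X and Y had finite values, so would the whole coordinate ring, and then everything integral
    over it. *)
Lemma at_infinity_polar phi :
  point_at_infinity j phi -> polar i j (ff_X C) (ff_Y C) phi.
Proof.
case=> Hphi naff; split=> //.
case px: (phi (ff_X C)) => [a|]; last by left.
case py: (phi (ff_Y C)) => [b|]; last by right.
case: naff => z zint; apply: (place_integral Hphi) zint => R.
by rewrite (place_eval2 Hphi R px py).
Qed.

Lemma one_infinity_polynomial_generator : [pchar k] =i pred0 ->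
  normalization_is_P1 C -> one_infinity j C ->
  exists t x y, [/\ rational_generator i t, ff_X C = evalp i t x
    & ff_Y C = evalp i t y].
Proof.
move=> char0 [theta [thetaC bij]] [phi [_ uniq]].
apply: (@polynomial_generator _ _ i kbar j char0 (ff_X C) (ff_Y C) _ (theta (tofrac 'X))).
  move=> psi1 psi2 /polar_at_infinity /uniq h1 /polar_at_infinity /uniq h2 z.
  by rewrite h1 h2.
exact: fraction_rational_generator.
Qed.

End ComponentAtInfinity.

(** * Degree over k(x(t)) *)

Section Degree.
Variables (k L : fieldType) (i : {rmorphism k -> L}).

Lemma sum_distinct_sizes_eq0 (p q r : {poly k}) :
  p + q + r = 0 ->
  (p != 0 -> q != 0 -> size p <> size q) ->
  (p != 0 -> r != 0 -> size p <> size r) ->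
  (q != 0 -> r != 0 -> size q <> size r) ->
  [/\ p = 0, q = 0 & r = 0].
Proof.
move=> e.
have sp : (size p <= maxn (size q) (size r))%N.
  have -> : p = - (q + r) by apply/eqP; rewrite -addr_eq0 addrA e.
  by rewrite size_polyN size_polyD.
have sq : (size q <= maxn (size p) (size r))%N.
  have -> : q = - (p + r) by apply/eqP; rewrite -addr_eq0 addrA [q + p]addrC e.
  by rewrite size_polyN size_polyD.
have sr : (size r <= maxn (size p) (size q))%N.
  have -> : r = - (p + q) by apply/eqP; rewrite -addr_eq0 addrC e.
  by rewrite size_polyN size_polyD.
rewrite -!size_poly_gt0 => pq pr qr.
suff [p0 q0 r0] : [/\ size p = 0, size q = 0 & size r = 0]%N.
  by split; apply/eqP; rewrite -size_poly_eq0 ?p0 ?q0 ?r0.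
move: sp sq sr pq pr qr; move: (size p) (size q) (size r) => a b c.
by move=> *; split; lia.
Qed.

(** Here d stands for deg x: the degree of r(x) t^n is n modulo d, and 0, 1, 2 stay distinct modulo
    d > 2. The case d = 0 is that of a constant x. *)
Lemma distinct_residues d m m' n n' :
  (d == 0 \/ 2 < d)%N -> (n < 3)%N -> (n' < 3)%N -> n != n' ->
  (m * d + n.+1 <> m' * d + n'.+1)%N.
Proof.
case=> [/eqP ->|d2] n3 n3' nn; first by move: nn; rewrite !muln0; lia.
rewrite !addnS => -[] /(congr1 (modn^~ d)); rewrite !modnMDl.
rewrite !modn_small; [exact/eqP| |];
  [exact: leq_ltn_trans _ d2 | exact: leq_ltn_trans _ d2].
Qed.

Lemma small_relation (x r0 r1 r2 : {poly k}) :
  ((size x <= 1) || (4 <= size x))%N ->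
  (r0 \Po x) + (r1 \Po x) * 'X + (r2 \Po x) * 'X^2 = 0 ->
  [/\ r0 \Po x = 0, r1 \Po x = 0 & r2 \Po x = 0].
Proof.
move=> sx e.
have sz r n : (r \Po x) * 'X^n != 0 ->
    exists m, size ((r \Po x) * 'X^n) = (m * (size x).-1 + n.+1)%N.
  move=> rn; have rx : r \Po x != 0 by apply: contraNneq rn => ->; rewrite mul0r.
  exists (size r).-1; rewrite size_mulXn // -size_comp_poly.
  by move: rx; rewrite -size_poly_gt0; case: (size _) => //= s _;
    rewrite addnC addnS addSn.
have H (a b : {poly k}) (n n' : 'I_3) : n != n' ->
    (a \Po x) * 'X^n != 0 -> (b \Po x) * 'X^n' != 0 ->
    size ((a \Po x) * 'X^n) <> size ((b \Po x) * 'X^n').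
  move=> nn /sz[m ->] /sz[m' ->].
  apply: (distinct_residues (d := (size x).-1)) => //; first by move: sx; lia.
have E0 (r : {poly k}) : (r \Po x) = (r \Po x) * 'X^0 by rewrite expr0 mulr1.
have [] := @sum_distinct_sizes_eq0 _ _ _ e.
- by move=> p0 q0; rewrite E0 -['X]expr1; apply: (H _ _ 0 1); rewrite // -?E0.
- by move=> p0 q0; rewrite E0; apply: (H _ _ 0 2%:R); rewrite // -?E0.
- by move=> p0 q0; rewrite -['X]expr1; apply: (H _ _ 1 2%:R).
by move=> -> /eqP + /eqP; rewrite !mulf_eq0 !polyX_eq0 !orbF => /eqP -> /eqP ->.
Qed.

(* Three elements of a plane are dependent, with coefficients given by minors. *)
Lemma ext_degree2_relation (x t : L) :
  ext_degree (in_simple_ext i x) 2 ->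
  exists w0 w1 w2 : L, [/\ in_simple_ext i x w0, in_simple_ext i x w1,
    in_simple_ext i x w2, w0 + w1 * t + w2 * t ^+ 2 = 0
    & ~ [/\ w0 = 0, w1 = 0 & w2 = 0]].
Proof.
case=> e [span _].
have coord z : exists a b, [/\ in_simple_ext i x a, in_simple_ext i x b
    & z = a * e ord0 + b * e (lift ord0 ord0)].
  have [c Sc zE] := span z; exists (c ord0), (c (lift ord0 ord0)).
  by rewrite zE !big_ord_recl big_ord0 addr0.
have [a0 [a1 [Sa0 Sa1 aE]]] := coord 1.
have [b0 [b1 [Sb0 Sb1 bE]]] := coord t.
have [c0 [c1 [Sc0 Sc1 cE]]] := coord (t ^+ 2).
have SN u : in_simple_ext i x u -> in_simple_ext i x (- u).
  move=> Su; rewrite -mulN1r -(rmorph1 i) -rmorphN.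
  by apply: in_simple_extM => //; apply: in_simple_ext_const.
have SD u v u' v' : in_simple_ext i x u -> in_simple_ext i x v ->
    in_simple_ext i x u' -> in_simple_ext i x v' ->
    in_simple_ext i x (u * v - u' * v').
  by move=> *; apply: in_simple_extD; [|apply: SN]; apply: in_simple_extM.
have S0 : in_simple_ext i x 0 by rewrite -(rmorph0 i); apply: in_simple_ext_const.
(* A nonzero minor gives the Cramer relation between 1, t, t^2; if it vanishes, 1 and t are already
   dependent. *)
have [w0|w0] := eqVneq (a0 * b1 - a1 * b0) 0; last first.
  exists (b0 * c1 - b1 * c0), (c0 * a1 - c1 * a0), (a0 * b1 - a1 * b0).
  split; try exact: SD; last by case=> _ _ /eqP; rewrite (negPf w0).
  rewrite -[X in X + _ + _]mulr1 {1}aE {1}bE cE.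
  by ring.
have [a00|a00] := eqVneq a0 0.
  have a10 : a1 != 0.
    apply: contraTneq (oner_neq0 L) => a10.
    by rewrite aE a00 a10 !mul0r addr0 eqxx.
  exists (- b1), a1, 0; split=> //; first exact: SN; last first.
    by case=> _ /eqP; rewrite (negPf a10).
  transitivity (- b1 * 1 + a1 * t); first by ring.
  transitivity (- (a0 * b1 - a1 * b0) * e ord0); last by rewrite w0 oppr0 mul0r.
  by rewrite {1}aE {1}bE; ring.
exists (- b0), a0, 0; split=> //; first exact: SN; last first.
  by case=> _ /eqP; rewrite (negPf a00).
transitivity (- b0 * 1 + a0 * t); first by ring.
transitivity ((a0 * b1 - a1 * b0) * e (lift ord0 ord0)); last by rewrite w0 mul0r.
by rewrite {1}aE {1}bE; ring.
Qed.

(** If all of L could serve as coefficients, e1 e0 - e0 e1 = 0 would force the basis to vanish, and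
    a zero basis is not free. *)
Lemma ext_degree2_not_generator (x : L) :
  ext_degree (in_simple_ext i x) 2 -> ~ forall z, in_simple_ext i x z.
Proof.
case=> e [_ free] gen.
have gen' (c : 'I_2 -> L) l : in_simple_ext i x (c l) by [].
pose c1 (l : 'I_2) := if l == ord0 then e (lift ord0 ord0) else - e ord0.
have c10 : forall l, c1 l = 0.
  apply: free => //; rewrite !big_ord_recl big_ord0 /c1 /= addr0.
  by rewrite mulNr mulrC subrr.
have e0 : e ord0 = 0.
  by have := c10 (lift ord0 ord0); rewrite /c1 /= => /eqP; rewrite oppr_eq0 => /eqP.
have e1 : e (lift ord0 ord0) = 0 by have := c10 ord0; rewrite /c1 eqxx.
have s0 : \sum_(l < 2) (1 : L) * e l = 0.
  by rewrite !big_ord_recl big_ord0 e0 e1 !mulr0 !addr0.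
by have /eqP := free (fun=> 1) (gen' _) s0 ord0; rewrite oner_eq0.
Qed.

Lemma size_of_ext_degree2 (t : L) (x : {poly k}) : rational_generator i t ->
  ext_degree (in_simple_ext i (evalp i t x)) 2 -> size x = 3.
Proof.
move=> [tr gen] deg.
have [sx|] := boolP ((size x <= 1) || (4 <= size x))%N.
  have [w0 [w1 [w2 [/in_simple_extP[a0 [b0 [/eqP n0 E0]]]
     /in_simple_extP[a1 [b1 [/eqP n1 E1]]]
     /in_simple_extP[a2 [b2 [/eqP n2 E2]]] rel nz]]]] := ext_degree2_relation t deg.
  case: nz; rewrite -!evalp_comp in n0 n1 n2 E0 E1 E2.
  (* The relation over k(x), cleared of its three denominators. *)
  have [] := @small_relation x (a0 * b1 * b2) (a1 * b0 * b2) (a2 * b0 * b1) sx.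
    apply: (transcendental_inj tr); rewrite !comp_polyM.
    rewrite !evalpD !evalpM evalpX.
    move: rel; rewrite E0 E1 E2 => /(congr1 (fun z =>
      z * (evalp i t (b0 \Po x) * evalp i t (b1 \Po x) * evalp i t (b2 \Po x)))).
    by rewrite mul0r => <-; field; rewrite n0 n1 n2.
  rewrite !comp_polyM => z0 z1 z2.
  have nzp q : evalp i t q != 0 -> q != 0.
    by apply: contraNneq => ->; rewrite evalp0.
  have cancel p q r : evalp i t q != 0 -> evalp i t r != 0 -> p * q * r = 0 -> p = 0.
    move=> /nzp q0 /nzp r0 /eqP; rewrite !mulf_eq0 (negPf q0) (negPf r0) !orbF.
    by move/eqP.
  by split; [rewrite E0 (cancel _ _ _ n1 n2 z0) | rewrite E1 (cancel _ _ _ n0 n2 z1)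
    | rewrite E2 (cancel _ _ _ n0 n1 z2)]; rewrite evalp0 mul0r.
rewrite negb_or -!ltnNge => /andP[s1 s4].
have [s2|] := eqVneq (size x) 2; last by move: s1 s4; case: (size x) => [|[|[|[|]]]].
(* Degree 1: t is an affine function of x, so k(x) is the whole field. *)
case: (ext_degree2_not_generator deg) => z.
apply: in_simple_ext_trans (gen z).
have xE : x = (x`_0)%:P + (x`_1)%:P * 'X by apply: size2_polyE; rewrite s2.
have x1 : x`_1 != 0.
  by have := lead_coef_eq0 x; rewrite /lead_coef s2 -size_poly_eq0 s2 => ->.
apply/in_simple_extP; exists ((x`_1)^-1 *: ('X - (x`_0)%:P)), 1.
rewrite evalp1 divr1; split; first exact/eqP/oner_neq0.
rewrite evalpZ evalpB evalpX evalpC {2}xE evalpD evalpM evalpX !evalpC.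
by rewrite addrC addKr fmorphV mulKf // fmorph_eq0.
Qed.

End Degree.

(** * The component attached to a decomposition *)

Section PairFunctionField.
Variables (k L : fieldType) (i : {rmorphism k -> L}) (t : L).
Hypothesis gt : rational_generator i t.
Variables (c beta alpha : k) (E : {poly k}).
Hypotheses (alpha0 : alpha != 0) (E0 : E != 0).

Local Notation x := (paramX alpha beta).
Local Notation y := (paramY c E).

Lemma param_kernel R : eval2 i (evalp i t x) (evalp i t y) R = 0 <->
  divides (pair_eqn c beta alpha E) R.
Proof.
rewrite eval2_evalp; split=> [/(transcendental_inj (proj1 gt))|].
  by move/(pair_eqn_kernel c beta alpha0 E0).
by move/(pair_eqn_kernel c beta alpha0 E0) => ->; rewrite evalp0.
Qed.

(* The values at (x(t), y(t)) of fractions in X, Y form a field that contains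
   t = (Y - c) / E(lambda_X(X)). *)
Lemma param_generated z : exists A B : {poly {poly k}},
  eval2 i (evalp i t x) (evalp i t y) B <> 0 /\
  z = eval2 i (evalp i t x) (evalp i t y) A /
      eval2 i (evalp i t x) (evalp i t y) B.
Proof.
set ev := eval2 i _ _.
have [tr gen] := gt.
pose D : {poly {poly k}} := (E \Po lambdaX alpha beta)%:P.
pose N : {poly {poly k}} := 'X - c%:P%:P.
have DE : ev D = evalp i t (E \Po 'X^2).
  by rewrite /ev eval2_evalp /D eval2C evalp_polyC -even_in_X.
have D0 : ev D != 0.
  by rewrite DE transcendental_neq0 // comp_poly_eq0 ?size_polyXn.
have NE : ev N = t * ev D.
  rewrite DE /ev eval2_evalp /N eval2B eval2Y eval2C evalpC /paramY.
  by rewrite [c%:P + _]addrC addrK evalpM evalpX.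
have evD P Q : ev (P + Q) = ev P + ev Q by exact: eval2D.
have evM P Q : ev (P * Q) = ev P * ev Q by exact: eval2M.
have evX P l : ev (P ^+ l) = ev P ^+ l by exact: eval2Xn.
have evC a : ev a%:P%:P = i a by rewrite /ev eval2C evalpC.
have poly_frac p : exists A n, evalp i t p = ev A / ev D ^+ n.
  elim/poly_ind: p => [|p a [A [n IH]]].
    by exists 0, 0%N; rewrite evalp0 /ev eval2_0 mul0r.
  exists (A * N + a%:P%:P * D ^+ n.+1), n.+1.
  rewrite evalpD evalpM evalpX evalpC IH evD !evM !evX evC NE exprS; field.
  by rewrite D0 expf_neq0.
have /in_simple_extP[p [q [/eqP q0 ->]]] := gen z.
have [A [n pE]] := poly_frac p; have [B [m qE]] := poly_frac q.
have B0 : ev B != 0 by apply: contraNneq q0 => B0; rewrite qE B0 mul0r.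
exists (A * D ^+ m), (B * D ^+ n); rewrite !evM !evX.
split; first by apply/eqP; rewrite mulf_neq0 ?expf_neq0.
rewrite pE qE; field.
by rewrite B0 !expf_neq0.
Qed.

Lemma ext_degree_param : ext_degree (in_simple_ext i (evalp i t x)) 2.
Proof.
have [tr gen] := gt.
have inS p q : q != 0 -> in_simple_ext i (evalp i t x)
    (evalp i t (p \Po 'X^2) / evalp i t (q \Po 'X^2)).
  move=> q0; apply/in_simple_extP.
  exists (p \Po lambdaX alpha beta), (q \Po lambdaX alpha beta).
  rewrite -!evalp_comp -!even_in_X //; split=> //; apply/eqP.
  by rewrite transcendental_neq0 // comp_poly_eq0 ?size_polyXn.
exists (fun l : 'I_2 => t ^+ l); split.
  move=> z; have /in_simple_extP[n [d [/eqP d0 ->]]] := gen z.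
  have d0' : d != 0 by apply: contraNneq d0 => ->; rewrite evalp0.
  (* This is d(-t): multiplying by it makes the denominator d(t) d(-t) a polynomial in t^2, hence in
     x. *)
  pose d' := (even_poly d \Po 'X^2) - (odd_poly d \Po 'X^2) * 'X.
  pose D := even_poly d ^+ 2 - odd_poly d ^+ 2 * 'X.
  have DE : D \Po 'X^2 = d * d'.
    rewrite /D comp_polyB !expr2 !comp_polyM comp_polyX.
    by rewrite -[X in _ = X * _]poly_even_odd /d'; ring.
  have d'0 : d' != 0.
    apply: contraNneq d0' => e; have [] := @even_odd_eq0 _ (even_poly d) (- odd_poly d).
      by rewrite rmorphN mulNr.
    move=> e0 /eqP; rewrite oppr_eq0 => /eqP o0.
    by rewrite -[d]poly_even_odd e0 o0 !comp_poly0 mul0r addr0.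
  have D0 : D != 0.
    by have := mulf_neq0 d0' d'0; rewrite -DE;
      apply: contraNneq => ->; rewrite comp_poly0.
  exists (fun l : 'I_2 => if l == ord0
    then evalp i t (even_poly (n * d') \Po 'X^2) / evalp i t (D \Po 'X^2)
    else evalp i t (odd_poly (n * d') \Po 'X^2) / evalp i t (D \Po 'X^2)).
    by move=> l; case: ifP => _; apply: inS.
  rewrite !big_ord_recl big_ord0 /= expr0 mulr1 expr1 addr0.
  have ndE : evalp i t (n * d') = evalp i t (even_poly (n * d') \Po 'X^2) +
      evalp i t (odd_poly (n * d') \Po 'X^2) * t.
    by rewrite -[in LHS](poly_even_odd (n * d')) evalpD evalpM evalpX.
  rewrite mulrAC -mulrDl -ndE DE !evalpM.
  by rewrite -mulf_div divff ?mulr1 // transcendental_neq0.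
move=> w Sw; rewrite !big_ord_recl big_ord0 addr0 expr0 mulr1 /= expr1.
have /in_simple_extP[a0 [b0 [/eqP n0 E0']]] := Sw ord0.
have /in_simple_extP[a1 [b1 [/eqP n1 E1']]] := Sw (lift ord0 ord0).
rewrite E0' E1' => e.
rewrite -!evalp_comp in n0 n1 E0' E1' e.
have [] : a0 * b1 = 0 /\ a1 * b0 = 0.
  have E1 : (1 : {poly k}) != 0 by exact: oner_neq0.
  (* With c = 0 and E = 1 the second coordinate is t itself, so this is the independence of 1 and t
     over k[x]. *)
  apply: (param_independent (c := 0) (beta := beta) alpha0 E1).
  apply: (transcendental_inj tr).
  rewrite /paramY polyC0 add0r rmorph1 /= mulr1 !comp_polyM !evalpD !evalpM evalpX.
  move/(congr1 (fun z => z * (evalp i t (b0 \Po x) * evalp i t (b1 \Po x)))): e.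
  by rewrite mul0r => <-; field; rewrite n0 n1.
have nz b : evalp i t (b \Po x) != 0 -> b != 0.
  by apply: contraNneq => ->; rewrite comp_poly0 evalp0.
move=> /eqP + /eqP; rewrite !mulf_eq0 (negPf (nz _ n0)) (negPf (nz _ n1)) !orbF.
move=> /eqP z0 /eqP z1 l; case: (unliftP ord0 l) => [l'|] ->.
  by rewrite ord1 E1' z1 comp_poly0 evalp0 mul0r.
by rewrite E0' z0 comp_poly0 evalp0 mul0r.
Qed.

Variables (kbar : closedFieldType) (j : {rmorphism k -> kbar}).

(** If x were finite, so would be t^2, an affine function of x; then 1 = t^2 (1/t)^2 would have
    value 0. *)
Lemma pole_param phi : is_place i j phi -> phi t = None ->
  phi (evalp i t x) = None.
Proof.
move=> Hphi pt; case px: (phi _) => [a|//].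
have ia0 : i alpha != 0 by rewrite fmorph_eq0.
have t0 := rational_generator_neq0 gt.
have pV := placeV_None Hphi pt.
have t2E : t ^+ 2 = i alpha^-1 * (evalp i t x + i (- beta)).
  by rewrite evalp_paramX rmorphN addrK fmorphV mulKf.
have pt2 := placeM Hphi (place_const Hphi alpha^-1)
  (placeD Hphi px (place_const Hphi (- beta))).
rewrite -t2E in pt2; have := placeM Hphi pt2 (placeXn Hphi 2 pV).
rewrite -exprMn mulfV // expr1n (place1 Hphi) expr0n mulr0 => -[/eqP].
by rewrite oner_eq0.
Qed.

(** A pole of x or y is a pole of t, and only one place sends 1/t to 0. *)
Lemma unique_polar_param : exists phi,
  polar i j (evalp i t x) (evalp i t y) phi /\
  forall psi, polar i j (evalp i t x) (evalp i t y) psi -> psi =1 phi.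
Proof.
have gV := rational_generatorV gt.
have tV0 := rational_generator_neq0 gV.
have [phi [Hphi ptV _]] := place_exists j 0 gV.
have pt : phi t = None by rewrite -[t]invrK; apply: (place_inv_Some0 Hphi).
exists phi; split; first by split=> //; left; apply: pole_param.
move=> psi [Hpsi xy]; apply: (place_unique gV Hpsi Hphi _ ptV).
apply: (placeV_None Hpsi); case qt: (psi t) => [a|//].
by case: xy; rewrite (place_evalp Hpsi _ qt).
Qed.

End PairFunctionField.

Section Construction.
Variables (k : fieldType) (f g : {poly k}) (c beta alpha : k) (E G : {poly k}).
Hypothesis dec : decomposition f g c beta alpha E G.

Lemma pair_eqn_divides_curve :
  divides (pair_eqn c beta alpha E) (curve_poly f g).
Proof.
case: dec => alpha0 E0 _ gE fE.
apply/(pair_eqn_kernel c beta alpha0 E0).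
rewrite /curve_poly eval2B eval2C eval2_map !evalp_polyC {1}gE fE -!comp_polyA.
apply/eqP; rewrite subr_eq0; apply/eqP; congr (_ \Po _).
rewrite -polF_comp -/(lambdaX alpha beta) (F_param c beta E alpha0) rmorphXn /=.
by rewrite comp_polyB comp_polyX comp_polyC.
Qed.

Let const : {rmorphism k -> {fraction {poly k}}} := @tofrac _ \o polyC.

Lemma fraction_generator : rational_generator const (tofrac 'X).
Proof.
apply: (@fraction_rational_generator _ _ const idfun) => //.
by exists id.
Qed.

(** The function field is modelled by Frac k[T] itself with t = T, so the identity is the
    isomorphism with k(t). *)
Lemma pair_component_exists (kbar : closedFieldType) (j : {rmorphism k -> kbar}) :
  exists C : component f g,
    [/\ comp_eqn C = pair_eqn c beta alpha E,
        rational_one_infinity_component j C,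
        d_X C 2,
        parametrized_by j (comp_eqn C) (paramX alpha beta) (paramY c E)
      & ~ graph_component C].
Proof.
have [alpha0 E0 _ _ _] := dec.
have gt := fraction_generator.
pose C : component f g := Component (prime_pair_eqn c beta alpha0 E0)
  pair_eqn_divides_curve (param_kernel gt c beta alpha0 E0)
  (param_generated gt c beta alpha0 E0).
exists C; split=> //.
- split.
  + rewrite /geom_integral /= map_pair_eqn.
    by apply: prime_pair_eqn; rewrite ?fmorph_eq0 ?map_poly_eq0.
  + exists (idfun : {rmorphism {fraction {poly k}} -> {fraction {poly k}}}).
    by split=> //; exists id.
  + have [phi [pphi uniq]] := unique_polar_param gt c beta E alpha0 j.
    exists phi; split; first exact: (@polar_at_infinity _ _ j _ _ C).
    by move=> psi /(@at_infinity_polar _ _ j _ _ C); apply: uniq.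
- exact: ext_degree_param.
- exact: parametrized_pair_eqn.
- case=> h [_ [dvd _]]; exact: (not_graph_pair_eqn alpha0 E0 dvd).
Qed.

End Construction.

(** * The decomposition attached to a component *)

Lemma parametrized_by_same_ideal (k : fieldType) (kbar : closedFieldType)
    (j : {rmorphism k -> kbar}) (P Q : {poly {poly k}}) (x y : {poly k}) :
  same_ideal P Q -> parametrized_by j Q x y -> parametrized_by j P x y.
Proof.
case=> PQ QP [ker gen pts]; split=> // [R|a b].
  by rewrite ker; split; apply: divides_trans.
rewrite -pts; have [[r rE] [s sE]] := (PQ, QP).
by split=> z; [rewrite rE|rewrite sE]; rewrite eval2M z mulr0.
Qed.

Section CharacteristicZero.
Variable k : fieldType.
Hypothesis char0 : [pchar k] =i pred0.

Lemma complete_square (x : {poly k}) : size x = 3 ->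
  exists alpha beta h : k, alpha != 0 /\ x = paramX alpha beta \Po ('X + h%:P).
Proof.
move=> sx; pose a := x`_2; pose b := x`_1; pose d := x`_0.
have a0 : a != 0.
  by have := lead_coef_eq0 x; rewrite /lead_coef sx -size_poly_eq0 sx /a => ->.
have two0 : (2%:R != 0 :> k) by exact: natf_neq0_char0 char0 1.
pose h := b / (2%:R * a).
exists a, (d - a * h ^+ 2), h; split=> //.
have bE : b = a * h *+ 2.
  by rewrite /h -mulr_natr; clearbody a b; field; rewrite two0 a0.
have -> : x = a *: 'X^2 + b *: 'X + d%:P.
  apply/polyP => l; rewrite !coefE; case: l => [|[|[|l]]] /=;
    rewrite ?mulr0 ?mulr1 ?addr0 ?add0r //.
  by rewrite nth_default // sx.
rewrite /paramX comp_polyD comp_polyZ comp_Xn_poly comp_polyC bE -!mul_polyC.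
by rewrite !(rmorphB, rmorphM, rmorphMn, rmorphXn) /=; ring.
Qed.

Section ComponentToDecomposition.
Variables (kbar : closedFieldType) (j : {rmorphism k -> kbar}).
Variables (f g : {poly k}) (C : component f g).
Hypothesis (hg : (1 < size g)%N).
Local Notation i := (ff_const C).

Lemma component_parametrization :
  normalization_is_P1 C -> one_infinity j C -> d_X C 2 ->
  exists (t : funfield C) (alpha beta : k) (y : {poly k}),
    [/\ rational_generator i t, alpha != 0,
        ff_X C = evalp i t (paramX alpha beta) & ff_Y C = evalp i t y].
Proof.
move=> P1 inf deg.
have [t [x [y [gt xE yE]]]] := one_infinity_polynomial_generator char0 P1 inf.
have sx : size x = 3 by apply: (size_of_ext_degree2 gt); rewrite -xE.
have [alpha [beta [h [alpha0 hE]]]] := complete_square sx.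
exists (t - i (- h)), alpha, beta, (y \Po ('X - h%:P)); split=> //.
- exact: rational_generatorB.
- have -> : t - i (- h) = evalp i t ('X + h%:P).
    by rewrite evalpD evalpX evalpC rmorphN opprK.
  by rewrite -evalp_comp -hE.
- by rewrite yE evalp_comp evalpB evalpX evalpC rmorphN opprK addrK.
Qed.

Lemma component_equation (t : funfield C) (x y : {poly k}) :
  rational_generator i t -> ff_X C = evalp i t x -> ff_Y C = evalp i t y ->
  f \Po x = g \Po y.
Proof.
move=> [tr _] xE yE; apply: (transcendental_eq tr).
have /ff_kernel := comp_divides C.
rewrite /curve_poly eval2B eval2C eval2_map xE yE -!evalp_comp.
by move/eqP; rewrite subr_eq0 => /eqP.
Qed.

Lemma odd_part_neq0 (t : funfield C) (x p q : {poly k}) :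
  rational_generator i t -> ff_X C = evalp i t (x \Po 'X^2) ->
  ff_Y C = evalp i t ((p \Po 'X^2) + 'X * (q \Po 'X^2)) -> q != 0.
Proof.
move=> [tr _] xE yE; apply/eqP => q0.
rewrite q0 comp_poly0 mulr0 addr0 in yE.
have [A [B [B0 tE]]] := ff_generated t.
have ev R : eval2 i (ff_X C) (ff_Y C) R =
    evalp i t (eval2 polyC x p R \Po 'X^2).
  rewrite xE yE eval2_evalp; congr evalp; symmetry.
  apply: (rmorph_eval2 (phi := polyC) (psi := polyC) (h := comp_poly 'X^2)) => a.
  exact: comp_polyC.
rewrite !ev in B0 tE; move/eqP: B0 => B0.
have tB := congr1 (fun z => z * evalp i t (eval2 polyC x p B \Po 'X^2)) tE.
rewrite divfK // in tB.
(* The relation t B(t^2) = A(t^2) splits by parity and kills the denominator B. *)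
have [] : - eval2 polyC x p A = 0 /\ eval2 polyC x p B = 0.
  apply: even_odd_eq0; apply: (transcendental_inj tr).
  by rewrite rmorphN /= evalpD evalpM evalpX [_ * t]mulrC tB -evalpD addNr evalp0.
by move=> _ e; move: B0; rewrite e comp_poly0 evalp0 eqxx.
Qed.

Lemma even_about_of_comp (c : k) (q : {poly k}) : q != 0 ->
  g \Po (c%:P + 'X * (q \Po 'X^2)) = g \Po (c%:P - 'X * (q \Po 'X^2)) ->
  exists G : {poly k}, (1 < size G)%N /\ g = G \Po (('X - c%:P) ^+ 2).
Proof.
move=> q0 e12; set v := 'X * _ in e12.
pose h := g \Po ('X + c%:P).
have two0 : (2%:R != 0 :> k) by exact: natf_neq0_char0 char0 1.
have vX : v != 0 by rewrite mulf_neq0 ?polyX_eq0 // comp_poly_eq0 ?size_polyXn.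
have sv : (1 < size (v ^+ 2))%N.
  have : 'X %| v ^+ 2 by rewrite expr2 dvdp_mulr // dvdp_mulr.
  by move/(dvdp_leq (expf_neq0 2 vX)); rewrite size_polyX.
(* Recentred at c, the hypothesis reads h(v) = h(-v), so 2 v o(v^2) = 0 for the odd part o of h; as
   v^2 is nonconstant, o = 0. *)
have oh : odd_poly h = 0.
  have hE (w : {poly k}) : g \Po (c%:P + w) = h \Po w.
    by rewrite /h -comp_polyA comp_polyD comp_polyX comp_polyC addrC.
  move: e12; rewrite !hE -{1 2}[h]poly_even_odd !comp_polyD !comp_polyM -!comp_polyA.
  rewrite !comp_Xn_poly !comp_polyX sqrrN mulrN => /addrI/eqP.
  rewrite -addr_eq0 -mulr2n -mulr_natl mulf_eq0 -polyC_natr polyC_eq0.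
  by rewrite (negPf two0) mulf_eq0 (negPf vX) orbF comp_poly_eq0 // => /eqP.
exists (even_poly h).
have gE : g = even_poly h \Po (('X - c%:P) ^+ 2).
  have hE : h = even_poly h \Po 'X^2.
    by rewrite -[LHS]poly_even_odd oh comp_poly0 mul0r addr0.
  have -> : g = h \Po ('X - c%:P).
    by rewrite /h -comp_polyA comp_polyD comp_polyX comp_polyC subrK comp_polyXr.
  by rewrite {1}hE -comp_polyA comp_Xn_poly.
split=> //; rewrite ltnNge; apply: contraL hg => /size1_polyC GE.
by rewrite gE GE comp_polyC -leqNgt size_polyC_leq1.
Qed.

Lemma component_decomposition :
  normalization_is_P1 C -> one_infinity j C -> d_X C 2 ->
  exists (c beta alpha : k) (E G : {poly k}),
    [/\ decomposition f g c beta alpha E G,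
        same_ideal (comp_eqn C) (pair_eqn c beta alpha E)
      & parametrized_by j (comp_eqn C) (paramX alpha beta) (paramY c E)].
Proof.
move=> P1 inf deg.
have [t [alpha [beta [y [gt alpha0 xE yE]]]]] := component_parametrization P1 inf deg.
have fg := component_equation gt xE yE.
pose p := even_poly y; pose E := odd_poly y.
have y_split : y = (p \Po 'X^2) + 'X * (E \Po 'X^2).
  by rewrite [_ * (_ \Po _)]mulrC poly_even_odd.
have E0 : E != 0.
  apply: (odd_part_neq0 gt (x := alpha *: 'X + beta%:P) (p := p)).
    by rewrite -paramX_comp.
  by rewrite -y_split.
(* g(y(t)) = f(x(t)) is invariant under t -> -t because x is even. *)
have yN : g \Po y = g \Po ((p \Po 'X^2) - 'X * (E \Po 'X^2)).
  have <- : y \Po (- 'X) = (p \Po 'X^2) - 'X * (E \Po 'X^2).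
    rewrite {1}y_split comp_polyD comp_polyM -!comp_polyA comp_Xn_poly comp_polyX.
    by rewrite sqrrN mulNr.
  rewrite comp_polyA -fg /= -comp_polyA /paramX comp_polyD comp_polyZ.
  by rewrite comp_polyC comp_Xn_poly sqrrN.
have [c pE] : exists c, p = c%:P.
  by apply: (comp_poly_even char0 hg E0); rewrite -y_split.
rewrite pE comp_polyC in y_split yN.
have yP : y = paramY c E by [].
have [G [sG gE]] : exists G : {poly k},
    (1 < size G)%N /\ g = G \Po (('X - c%:P) ^+ 2).
  by apply: (even_about_of_comp E0); rewrite -y_split.
have same : same_ideal (comp_eqn C) (pair_eqn c beta alpha E).
  (* Both elements generate the kernel of evaluation at the same point (x(t), y(t)). *)
  have H R : divides (comp_eqn C) R <-> divides (pair_eqn c beta alpha E) R.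
    rewrite -ff_kernel xE yE yP; exact: param_kernel.
  by split; [apply/H | apply/H]; apply: divides_refl.
exists c, beta, alpha, E, G; split=> //; last first.
  exact: parametrized_by_same_ideal same (parametrized_pair_eqn c beta alpha0 E0 j).
split=> //; apply/eqP; rewrite -subr_eq0.
have sx : (1 < size (paramX alpha beta))%N.
  rewrite /paramX size_polyDl size_scale ?size_polyXn //.
  by apply: leq_ltn_trans (size_polyC_leq1 _) _.
(* The formula for f is checked after composing with the nonconstant x, which loses nothing. *)
rewrite -(comp_poly_eq0 _ sx) comp_polyB subr_eq0 fg {1}gE -!comp_polyA.
apply/eqP; congr (_ \Po _).
rewrite -polF_comp -/(lambdaX alpha beta) (F_param c beta E alpha0) -yP rmorphXn /=.
by rewrite comp_polyB comp_polyX comp_polyC.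
Qed.

End ComponentToDecomposition.
End CharacteristicZero.

Theorem proposition8p8 (k : fieldType) (kbar : closedFieldType)
    (j : {rmorphism k -> kbar})
    (hchar : [pchar k] =i pred0)
    (hkbar : forall z : kbar, algebraicOver j z)
    (f g : {poly k}) (hf : (1 < size f)%N) (hg : (1 < size g)%N) :
  (* every such component comes from the switched first-kind pair *)
  (forall C : component f g,
     rational_one_infinity_component j C -> d_X C 2 -> ~ graph_component C ->
     exists (c beta alpha : k) (E G : {poly k}),
       [/\ decomposition f g c beta alpha E G,
           same_ideal (comp_eqn C) (pair_eqn c beta alpha E)
         & parametrized_by j (comp_eqn C) (paramX alpha beta) (paramY c E)])
  /\
  (* existence criterion *)
  ((exists C : component f g,
      [/\ rational_one_infinity_component j C, d_X C 2
        & ~ graph_component C])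
   <->
   (exists (c beta alpha : k) (E G : {poly k}),
      decomposition f g c beta alpha E G))
  /\
  (* equivalent form: f = G o F o lambda_X and g = G o Q o lambda_Y *)
  (forall (c beta alpha : k) (E G : {poly k}),
     decomposition f g c beta alpha E G <->
     [/\ alpha != 0, E != 0, (1 < size G)%N,
         f = (G \Po polF E) \Po lambdaX alpha beta
       & g = (G \Po polQ k) \Po lambdaY c])
  /\
  (* (F, Q) is the switched first-kind pair with m = 2, r = 1, a = 1, p = E *)
  (forall E : {poly k}, E != 0 ->
     switched_first_kind_pair 2 1 1 E (polF E) (polQ k))
  /\
  (* the component corresponding to given c, beta, alpha, E, G *)
  (forall (c beta alpha : k) (E G : {poly k}),
     decomposition f g c beta alpha E G ->
     parametrized_by j (curve_poly (polF E) (polQ k))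
       'X^2 ('X * (E \Po 'X^2)) /\
     exists C : component f g,
       [/\ comp_eqn C = pair_eqn c beta alpha E,
           rational_one_infinity_component j C,
           d_X C 2,
           parametrized_by j (comp_eqn C) (paramX alpha beta) (paramY c E)
         & ~ graph_component C]).
Proof.
have forward (C : component f g) :
    rational_one_infinity_component j C -> d_X C 2 ->
    exists (c beta alpha : k) (E G : {poly k}),
      [/\ decomposition f g c beta alpha E G,
          same_ideal (comp_eqn C) (pair_eqn c beta alpha E)
        & parametrized_by j (comp_eqn C) (paramX alpha beta) (paramY c E)].
  by case=> _ P1 inf deg; apply: component_decomposition.
have backward := @pair_component_exists k f g.
split; first by move=> C rat deg _; apply: forward.
split.
  split=> [[C [rat deg _]]|[c [beta [alpha [E [G dec]]]]]].
    have [c [beta [alpha [E [G [dec _ _]]]]]] := forward C rat deg.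
    by exists c, beta, alpha, E, G.
  have [C [_ rat deg _ ngr]] := backward _ _ _ _ _ dec _ j.
  by exists C.
split.
  move=> c beta alpha E G.
  have -> : (G \Po polQ k) \Po lambdaY c = G \Po (('X - c%:P) ^+ 2).
    by rewrite -comp_polyA /polQ /lambdaY comp_Xn_poly.
  rewrite -[(G \Po polF E) \Po _]comp_polyA polF_comp.
  by split=> -[].
split.
  by move=> E E0; split; rewrite ?oner_eq0 // /polF expr1 scale1r.
move=> c beta alpha E G dec; split; last exact: backward dec _ j.
have [_ E0 _ _ _] := dec.
(* The curve in the coordinates U, V is the instance c = beta = 0, alpha = 1. *)
have := parametrized_pair_eqn 0 0 (oner_neq0 k) E0 j.
rewrite /pair_eqn /paramX /paramY /lambdaX /lambdaY invr1 !scale1r !polyC0.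
by rewrite !subr0 add0r addr0 !comp_polyXr.
Qed.
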